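(* Let $\delta,D,H\ge0$. There exists $A=A(\delta,D,H)\ge1$ such that for every $(X,x,\Gamma)\in\mathcal{M}(\delta,D)$ with $h_\Gamma\le H$ and every Patterson–Sullivan measure $\mu_{\mathrm{PS}}$ of $\Gamma$ (with basepoint $x$), one has $$\frac1A\rho^{h_\Gamma}\le\mu_{\mathrm{PS}}(B(z,\rho))\le A\rho^{h_\Gamma}$$ for all $z\in\Lambda(\Gamma)$ and all $0<\rho\le1$, where $B(z,\rho)$ is the generalized visual ball.
   Context: Gromov product: $(y,z)_x=\frac12(d(x,y)+d(x,z)-d(y,z))$; $X$ is $\delta$-hyperbolic if $(x,z)_w\geq\min\{(x,y)_w,(y,z)_w\}-\delta$ for all points. $\partial X$ is the Gromov boundary; for $z,z'\in\partial X$, $(z,z')_x=\sup\liminf_{n,m\to\infty}(z_n,z'_m)_x$, sup over sequences $(z_n)\to z$, $(z'_m)\to z'$. Generalized visual ball: $B(z,\rho)=\{z'\in\partial X:(z,z')_x>\log\frac1\rho\}$. Limit set $\Lambda(\Gamma)$: accumulation points in $\partial X$ of $\Gamma x$; elementary means $\#\Lambda(\Gamma)\le2$. $\mathrm{QC\text{-}Hull}(C)$: union of geodesic lines with both endpoints in $C\subseteq\partial X$. Quasiconvex-cocompact with codiameter $\le D$: for all $y,y'\in\mathrm{QC\text{-}Hull}(\Lambda(\Gamma))$ there is $g\in\Gamma$ with $d(gy,y')\le D$. $\mathcal{M}(\delta,D)$: triples $(X,x,\Gamma)$, $X$ proper geodesic $\delta$-hyperbolic, $\Gamma\le\mathrm{Isom}(X)$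 discrete, torsion-free, non-elementary, quasiconvex-cocompact with codiameter $\le D$, $x\in\mathrm{QC\text{-}Hull}(\Lambda(\Gamma))$. Critical exponent $h_\Gamma=\inf\{s\ge0:\sum_{g\in\Gamma}e^{-sd(x,gx)}<\infty\}$ (equivalently $\limsup\frac1T\log\#(\Gamma x\cap\overline B(x,T))$). For $s>h_\Gamma$ let $\mu_s=\big(\sum_{g}e^{-sd(x,gx)}\big)^{-1}\sum_g e^{-sd(x,gx)}\Delta_{gx}$ (Dirac masses) on the compact space $X\cup\partial X$; a Patterson–Sullivan measure is any weak-$*$ limit of $\mu_{s_i}$ for a sequence $s_i\downarrow h_\Gamma$. *)

(* Defs.v *)
From HB Require Import structures.
From mathcomp Require Import all_boot all_order all_algebra.
From mathcomp Require Import all_classical all_reals.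
From mathcomp Require Import ereal topology normedtype sequences esum exp measure lebesgue_integral.



Unset Printing Implicit Defensive.
Import Order.TTheory GRing.Theory Num.Theory numFieldNormedType.Exports.
Local Open Scope classical_set_scope.
Local Open Scope ring_scope.

Definition is_metric {R : realType} {X : Type} (d : X -> X -> R) : Prop :=
  (forall a b, d a b = 0 <-> a = b) /\
  (forall a b, d a b = d b a) /\
  (forall a b c, d a c <= d a b + d b c).

Definition mconv {R : realType} {X : Type} (d : X -> X -> R)
  (u : nat -> X) (y : X) : Prop :=
  forall e : R, 0 < e -> exists N : nat, forall n, (N <= n)%N -> d (u n) y < e.

Definition mcompact {R : realType} {X : Type} (d : X -> X -> R) (K : set X) : Prop :=
  forall u : nat -> X, (forall n, K (u n)) ->
    exists phi : nat -> nat, (forall n, (phi n < phi n.+1)%N) /\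
      exists y, K y /\ mconv d (fun n => u (phi n)) y.

Definition is_proper {R : realType} {X : Type} (d : X -> X -> R) : Prop :=
  forall (y : X) (r : R), mcompact d [set z | d y z <= r].

Definition is_geodesic {R : realType} {X : Type} (d : X -> X -> R) : Prop :=
  forall a b : X, exists g : R -> X,
    g 0 = a /\ g (d a b) = b /\
    forall s t, 0 <= s <= d a b -> 0 <= t <= d a b -> d (g s) (g t) = `|s - t|.

Definition gprod {R : realType} {X : Type} (d : X -> X -> R) (w y z : X) : R :=
  (d w y + d w z - d y z) / 2.

Definition is_hyperbolic {R : realType} {X : Type} (d : X -> X -> R) (delta : R) : Prop :=
  forall w a b c : X,
    gprod d w a c >= Num.min (gprod d w a b) (gprod d w b c) - delta.

Definition conv_inf {R : realType} {X : Type} (d : X -> X -> R) (o : X)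
  (u : nat -> X) : Prop :=
  forall r : R, exists N : nat, forall n m, (N <= n)%N -> (N <= m)%N ->
    r < gprod d o (u n) (u m).

Definition seq_equiv {R : realType} {X : Type} (d : X -> X -> R) (o : X)
  (u v : nat -> X) : Prop :=
  forall r : R, exists N : nat, forall n m, (N <= n)%N -> (N <= m)%N ->
    r < gprod d o (u n) (v m).

Definition bclass {R : realType} {X : Type} (d : X -> X -> R) (o : X)
  (u : nat -> X) : set (nat -> X) :=
  [set v | conv_inf d o v /\ seq_equiv d o u v].

Definition is_bpoint {R : realType} {X : Type} (d : X -> X -> R) (o : X)
  (C : set (nat -> X)) : Prop :=
  exists u, conv_inf d o u /\ C = bclass d o u.

Definition bvalid {R : realType} {X : Type} (d : X -> X -> R) (o : X)
  (p : X + set (nat -> X)) : Prop :=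
  match p with
  | inl _ => True
  | inr C => is_bpoint d o C
  end.

(* The bordification  X ∪ ∂X  (points of X are [inl y], boundary points
   are [inr C] with C an equivalence class). *)
Definition Bord {R : realType} {X : Type} (d : X -> X -> R) (o : X) : Type :=
  {p : X + set (nat -> X) | bvalid d o p}.

HB.instance Definition _ {R : realType} {X : Type} (d : X -> X -> R) (o : X) :=
  gen_eqMixin (Bord d o).
HB.instance Definition _ {R : realType} {X : Type} (d : X -> X -> R) (o : X) :=
  gen_choiceMixin (Bord d o).
HB.instance Definition _ {R : realType} {X : Type} (d : X -> X -> R) (o : X) :=
  isPointed.Build (Bord d o) (exist (bvalid d o) (inl o) I).

Definition bpt {R : realType} {X : Type} (d : X -> X -> R) (o : X) (y : X) : Bord d o :=
  exist (bvalid d o) (inl y) I.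

Definition is_bd {R : realType} {X : Type} {d : X -> X -> R} {o : X} (p : Bord d o) : Prop :=
  match sval p with inl _ => False | inr _ => True end.

Definition seqs {R : realType} {X : Type} {d : X -> X -> R} {o : X} (p : Bord d o) :
  set (nat -> X) :=
  match sval p with
  | inl y => [set (fun _ : nat => y)]
  | inr C => C
  end.

Definition dliminf {R : realType} (u : nat -> nat -> R) : \bar R :=
  ereal_sup [set ereal_inf [set y | exists n m, (N <= n)%N /\ (N <= m)%N /\ y = (u n m)%:E]
            | N in [set: nat]].

(* extended Gromov product on X ∪ ∂X (sup of liminf over representing sequences);
   on X it coincides with gprod, on ∂X it is the product of the context *)
Definition egp {R : realType} {X : Type} {d : X -> X -> R} {o : X} (p q : Bord d o) : \bar R :=
  ereal_sup [set l | exists a b, seqs p a /\ seqs q b /\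
                      l = dliminf (fun n m => gprod d o (a n) (b m))].

Definition bconv {R : realType} {X : Type} {d : X -> X -> R} {o : X}
  (q : nat -> Bord d o) (p : Bord d o) : Prop :=
  match sval p with
  | inl y => forall e : R, 0 < e -> exists N : nat, forall n, (N <= n)%N ->
               exists z, sval (q n) = inl z /\ d z y < e
  | inr _ => forall r : R, exists N : nat, forall n, (N <= n)%N -> (r%:E < egp (q n) p)%E
  end.

(* open sets of X ∪ ∂X (the topology is metrizable, hence sequential) *)
Definition bopen {R : realType} {X : Type} {d : X -> X -> R} {o : X}
  (U : set (Bord d o)) : Prop :=
  forall p q, U p -> bconv q p -> exists N : nat, forall n, (N <= n)%N -> U (q n).

Definition bcont {R : realType} {X : Type} {d : X -> X -> R} {o : X}
  (f : Bord d o -> R) : Prop :=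
  forall p q, bconv q p ->
    forall e : R, 0 < e -> exists N : nat, forall n, (N <= n)%N -> `|f (q n) - f p| < e.

Definition BordM {R : realType} {X : Type} (d : X -> X -> R) (o : X) :=
  g_sigma_algebraType (@bopen R X d o).

Definition vball {R : realType} {X : Type} {d : X -> X -> R} {o : X}
  (z : Bord d o) (rho : R) : set (BordM d o) :=
  [set p : Bord d o | is_bd p /\ ((ln (1 / rho))%:E < egp z p)%E].

Definition is_isometry {R : realType} {X : Type} (d : X -> X -> R) (g : X -> X) : Prop :=
  (forall a b, d (g a) (g b) = d a b) /\ (forall b, exists a, g a = b).

Definition is_isom_group {R : realType} {X : Type} (d : X -> X -> R) (G : set (X -> X)) : Prop :=
  (forall g, G g -> is_isometry d g) /\
  G id /\
  (forall g h, G g -> G h -> G (g \o h)) /\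
  (forall g, G g -> exists h, G h /\ g \o h = id /\ h \o g = id).

(* discrete for the compact-open topology (= topology of uniform
   convergence on compact sets) *)
Definition is_discrete {R : realType} {X : Type} (d : X -> X -> R) (G : set (X -> X)) : Prop :=
  forall g, G g -> exists K : set X, mcompact d K /\
    exists e : R, 0 < e /\
      forall h, G h -> (forall y, K y -> d (h y) (g y) < e) -> h = g.

Definition torsion_free {X : Type} (G : set (X -> X)) : Prop :=
  forall g, G g -> forall n : nat, (0 < n)%N -> iter n g = id -> g = id.

Definition limit_set {R : realType} {X : Type} (d : X -> X -> R) (x : X)
  (G : set (X -> X)) : set (Bord d x) :=
  [set p | is_bd p /\ exists gs : nat -> (X -> X),
             (forall n, G (gs n)) /\ seqs p (fun n => gs n x)].

Definition non_elementary {R : realType} {X : Type} (d : X -> X -> R) (x : X)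
  (G : set (X -> X)) : Prop :=
  ~ exists a b : Bord d x, forall p, limit_set d x G p -> p = a \/ p = b.

Definition qc_hull {R : realType} {X : Type} (d : X -> X -> R) (x : X)
  (C : set (Bord d x)) : set X :=
  [set y | exists gam : R -> X, (forall s t, d (gam s) (gam t) = `|s - t|) /\
       (exists p q, C p /\ C q /\ seqs p (fun n => gam n%:R) /\
                    seqs q (fun n => gam (- n%:R))) /\
       exists t, gam t = y].

Definition qc_cocompact {R : realType} {X : Type} (d : X -> X -> R) (x : X)
  (G : set (X -> X)) (D : R) : Prop :=
  forall y y', qc_hull d x (limit_set d x G) y -> qc_hull d x (limit_set d x G) y' ->
    exists g, G g /\ d (g y) y' <= D.

Definition in_M {R : realType} (delta D : R) {X : Type} (d : X -> X -> R) (x : X)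
  (G : set (X -> X)) : Prop :=
  is_metric d /\ is_proper d /\ is_geodesic d /\ is_hyperbolic d delta /\
  is_isom_group d G /\ is_discrete d G /\ torsion_free G /\
  non_elementary d x G /\ qc_cocompact d x G D /\
  qc_hull d x (limit_set d x G) x.

Definition poincare {R : realType} {X : Type} (d : X -> X -> R) (x : X)
  (G : set (X -> X)) (s : R) : \bar R :=
  \esum_(g in (G : set {classic (X -> X)})) (expR (- (s * d x (g x))))%:E.

Definition crit_exp {R : realType} {X : Type} (d : X -> X -> R) (x : X)
  (G : set (X -> X)) : \bar R :=
  ereal_inf [set s%:E | s in [set s : R | 0 <= s /\ (poincare d x G s < +oo)%E]].

(* integral of f against mu_s = (sum_g e^{-s d(x,gx)})^{-1} sum_g e^{-s d(x,gx)} Dirac_{gx} *)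
Definition ps_int {R : realType} {X : Type} (d : X -> X -> R) (x : X)
  (G : set (X -> X)) (s : R) (f : Bord d x -> R) : R :=
  (fine (\esum_(g in (G : set {classic (X -> X)})) (expR (- (s * d x (g x))) * Num.max (f (bpt d x (g x))) 0)%:E)
   - fine (\esum_(g in (G : set {classic (X -> X)})) (expR (- (s * d x (g x))) * Num.max (- f (bpt d x (g x))) 0)%:E))
  / fine (poincare d x G s).

Definition is_PS {R : realType} {X : Type} (d : X -> X -> R) (x : X)
  (G : set (X -> X)) (h : R) (nu : {measure set (BordM d x) -> \bar R}) : Prop :=
  exists s : nat -> R,
    (forall i, h < s i) /\ (forall i, s i.+1 <= s i) /\ (s @ \oo --> h) /\
    forall f : Bord d x -> R, bcont f ->
      ((fun i => (ps_int d x G (s i) f)%:E) @ \oo --> \int[nu]_p (f p)%:E)%E.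

(* Main.v *)
(** All estimates are made on the orbital sums [M(U) = sum_(g in U) exp (- s d(x, g x))] with
    [s] slightly above the critical exponent [h], where they only involve [delta], [D] and a bound
    on [s]; the conclusion follows by testing the weak limit against continuous functions.

    Since the hull is quasiconvex (limits of geodesics give enough lines with endpoints in the
    limit set), every geodesic segment between orbit points stays near the orbit. Hence a visual
    ball of radius [rho] is comparable to the shadow of some [g x] with [d(x, g x)] close to
    [log (1 / rho)].  Left translation by [g^-1] bounds the mass of that shadow above by a constant
    times [exp (- s d(x, g x))] times the total mass. For the lower bound the complement of the
    translated shadow must not carry most of the mass; it lies in the shadow of an orbit point at
    distance [K], of mass at most [C exp (- s K)], so a lower bound on [s] is enough. This lower
    bound comes from three orbit points seen from [x] in different directions: the cones over them
    are disjoint, and each contains a translate of two of the three cones.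

    The measure gives no mass to [X] because the Poincare series diverges at [h]: if it converged,
    a small tail on one annulus would make the series converge for some [s < h]. *)
Require Import Defs.
From HB Require Import structures.
From mathcomp Require Import all_boot all_order all_algebra.
From mathcomp Require Import all_classical all_reals.
From mathcomp Require Import ereal topology normedtype sequences esum exp measure lebesgue_integral.
From mathcomp Require Import numfun lebesgue_stieltjes_measure measurable_realfun.
From mathcomp Require Import ring lra zify.
Import Order.TTheory GRing.Theory Num.Theory numFieldNormedType.Exports.
Local Open Scope classical_set_scope.
Local Open Scope ring_scope.

(** * Gromov products *)

(** Above the critical exponent all masses are finite and left translation is an injective change of
    variables in the sums, so no quasi-invariance of the limit measure has to be established. The
    price is the passage from [s] to [h]: for a fixed ball, [s] is taken so close to [h] that
    [(s - h) * ln (1 / rho) <= 1], which costs only a factor [expR 1].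

    Two obstacles come from the boundary. The extended Gromov product is a supremum of lower limits
    and need not be continuous, so visual balls are in general neither open nor closed: their
    measurability is derived from upper semicontinuity of the product, and they are compared with
    the weak limit through continuous functions cut out of a Frink-type chain distance. Moreover the
    approximating measures live on [X], so these functions are positive on parts of [X] too; the
    lower bound first controls a visual ball together with [X], and this is where the vanishing of
    the measure on [X] enters. *)

Definition geod {R : realType} {X : Type} (d : X -> X -> R) (a b : X) (g : R -> X) :=
  g 0 = a /\ g (d a b) = b /\
    forall s t, 0 <= s <= d a b -> 0 <= t <= d a b -> d (g s) (g t) = `|s - t|.

Section Geometry.
Context {R : realType} {X : Type} (d : X -> X -> R) (delta : R).
Hypothesis met : is_metric d.
Hypothesis hyp : is_hyperbolic d delta.
Hypothesis geo : is_geodesic d.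
Hypothesis delta0 : 0 <= delta.
Implicit Types (a b c e w v y : X) (r : R).
Local Notation gp := (gprod d).

Lemma dxx a : d a a = 0.
Proof. by case: met => h _; apply/h. Qed.
Lemma dC a b : d a b = d b a.
Proof. by case: met => _ [h _]. Qed.
Lemma dtri a b c : d a c <= d a b + d b c.
Proof. by case: met => _ [_ h]. Qed.
Lemma d_ge0 a b : 0 <= d a b.
Proof. by have := dtri a b a; rewrite dxx (dC b a); lra. Qed.
Lemma gpC w a b : gp w a b = gp w b a.
Proof. by rewrite /gprod (dC a b); lra. Qed.
Lemma gp_ge0 w a b : 0 <= gp w a b.
Proof. by rewrite /gprod; have := dtri a w b; rewrite (dC a w); lra. Qed.
Lemma gp_lel w a b : gp w a b <= d w a.
Proof. by rewrite /gprod; have := dtri w a b; lra. Qed.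
Lemma gp_ler w a b : gp w a b <= d w b.
Proof. by rewrite gpC gp_lel. Qed.
Lemma gpxx w a : gp w a a = d w a.
Proof. by rewrite /gprod dxx; lra. Qed.
Lemma gp_lipr w a b c : gp w a b <= gp w a c + d b c.
Proof.
rewrite /gprod; have := dtri w c b; have := dtri a b c; rewrite (dC c b); lra.
Qed.
Lemma gp_lipl w a b c : gp w a c <= gp w b c + d a b.
Proof. by rewrite (gpC w a) (gpC w b) gp_lipr. Qed.
Lemma gp_base w v a b : gp w a b <= gp v a b + d w v.
Proof.
rewrite /gprod; have := dtri w v a; have := dtri w v b; lra.
Qed.
Lemma gp_swap w v a : gp w v a + gp v w a = d w v.
Proof. by rewrite /gprod (dC v w); lra. Qed.

Lemma hyp3 w a b c r : r <= gp w a b -> r <= gp w b c -> r - delta <= gp w a c.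
Proof.
move=> h1 h2; have := hyp w a b c; apply: le_trans; rewrite lerD2r le_min.
by rewrite h1 h2.
Qed.
Lemma hyp3_or w a b c r : gp w a c < r - delta -> gp w a b < r \/ gp w b c < r.
Proof.
move=> h; have [h1|] := ltP (gp w a b) r; first by left.
have [h2|] := ltP (gp w b c) r; first by right.
by move=> h2 h1; have := hyp3 w a b c r h1 h2; rewrite leNgt h.
Qed.
Lemma hyp4 w a b c e r : r <= gp w a b -> r <= gp w b c -> r <= gp w c e ->
  r - 2 * delta <= gp w a e.
Proof.
move=> h1 h2 h3; have h4 := hyp3 _ _ _ _ _ h1 h2.
have h5 : r - delta <= gp w c e by move: delta0; lra.
by have := hyp3 _ _ _ _ _ h4 h5; lra.
Qed.

Lemma gp_isom g w a b : is_isometry d g -> gp (g w) (g a) (g b) = gp w a b.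
Proof. by case=> h _; rewrite /gprod !h. Qed.

(** Hyperbolicity based at [a], applied to [y], [b] and the point at parameter [gp a y b]: both
    products with [b] are at least that parameter, which bounds the distance from [y]. *)
Lemma near_geod a b g y : geod d a b g ->
  0 <= gp a y b <= d a b /\ d y (g (gp a y b)) <= gp y a b + 2 * delta.
Proof.
move=> [g0 [g1 gi]].
have hr : 0 <= gp a y b <= d a b by rewrite gp_ge0 gp_ler.
split=> //; set t := gp a y b in hr *.
have h0 : 0 <= (0 : R) <= d a b by rewrite lexx d_ge0.
have h1 : 0 <= d a b <= d a b by rewrite lexx d_ge0.
have e1 : d a (g t) = t.
  by rewrite -{1}g0 gi // sub0r normrN ger0_norm //; case/andP: hr.
have e2 : d (g t) b = d a b - t.
  by rewrite -{1}g1 gi // distrC ger0_norm // subr_ge0; case/andP: hr.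
have h2 : t <= gp a b (g t).
  by rewrite /gprod e1 (dC b) e2; lra.
have := hyp3 a y b (g t) t (lexx _) h2.
have : gp a y b + gp y a b = d a y by rewrite gp_swap.
rewrite -/t {2}/gprod e1.
lra.
Qed.

Lemma geod_pt a b t : 0 <= t <= d a b -> exists c, d a c = t /\ d c b = d a b - t.
Proof.
move=> ht; have [g [g0 [g1 gi]]] := geo a b; exists (g t).
have h0 : 0 <= (0 : R) <= d a b by rewrite lexx d_ge0.
have h1 : 0 <= d a b <= d a b by rewrite lexx d_ge0.
case/andP: (ht) => t0 t1; split.
  by rewrite -{1}g0 gi // sub0r normrN ger0_norm.
by rewrite -{1}g1 gi // distrC ger0_norm // subr_ge0.
Qed.
End Geometry.

(** * Ultralimits and geodesic lines *)

(** Limits along one ultrafilter exist for all real parameters of a line at once, which replaces the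
    diagonal extraction of the Arzela-Ascoli argument. *)
Lemma nonprincipal_ultrafilter :
  exists U : set_system nat, UltraFilter U /\ forall N : nat, U [set n | (N <= n)%N].
Proof.
have [U [UU sU]] := @ultraFilterLemma nat \oo eventually_filter.
by exists U; split=> // N; apply: sU; exists N.
Qed.

Section Ultra.
Context (U : set_system nat).
Hypothesis UU : UltraFilter U.

Lemma ultraI (A B : set nat) : U A -> U B -> U (A `&` B).
Proof. exact: filterI. Qed.
Lemma ultraS (A B : set nat) : A `<=` B -> U A -> U B.
Proof. exact: filterS. Qed.
Lemma ultra_ex (A : set nat) : U A -> exists n, A n.
Proof. exact: filter_ex. Qed.
Lemma ultraVC (A : set nat) : U A \/ U (~` A).
Proof. exact: in_ultra_setVsetC. Qed.
End Ultra.
Arguments ultraI {U} UU {A B}.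
Arguments ultraS {U} UU {A B}.
Arguments ultra_ex {U} UU {A}.

Section UltraLimits.
Context {R : realType} {X : Type} (d : X -> X -> R).
Hypothesis met : is_metric d.
Context (U : set_system nat).
Hypothesis UU : UltraFilter U.
Hypothesis UN : forall N : nat, U [set n | (N <= n)%N].

Lemma ultra_ex_ge (P : set nat) N : U P -> exists n, (N <= n)%N /\ P n.
Proof. by move=> UP; have /(ultra_ex UU)[n [Pn Nn]] := ultraI UU UP (UN N); exists n. Qed.

Lemma mcompact_net (K : set X) (e : R) : mcompact d K -> 0 < e ->
  exists l : seq X, forall y, K y -> exists p, List.In p l /\ d p y < e.
Proof.
move=> cK e0; apply: contrapT => /forallNP H.
have H' (l : seq X) : exists y, K y /\ forall p, List.In p l -> e <= d p y.
  have /existsNP[y /not_implyP[Ky /forallNP h]] := H l; exists y; split=> // p pl.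
  by rewrite leNgt; apply/negP => q; apply: (h p).
have [f Hf] := choice H'.
(* [s n] lists the points chosen so far; each new point stays [e] away from all earlier ones, so no
   subsequence converges. *)
pose s := fix s n := if n is n'.+1 then f (s n') :: s n' else [::].
have sin m n : (m < n)%N -> List.In (f (s m)) (s n).
  elim: n => // n IH; rewrite ltnS leq_eqVlt => /orP[/eqP->|/IH]; first by left.
  by right.
have sep m n : (m < n)%N -> e <= d (f (s m)) (f (s n)).
  by move=> mn; apply: (Hf (s n)).2; apply: sin.
have [phi [phiS [y [Ky cy]]]] := cK (fun n => f (s n)) (fun n => (Hf (s n)).1).
have e2 : 0 < e / 2 by rewrite divr_gt0.
have [N hN] := cy _ e2.
have h1 := hN N (leqnn N); have h2 := hN N.+1 (leqnSn N).
have := sep _ _ (phiS N); have := dtri d met (f (s (phi N))) y (f (s (phi N.+1))).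
rewrite (dC d met y); lra.
Qed.

Lemma ultra_finite_union {T : Type} (l : seq T) (P : T -> set nat) :
  U [set n | exists p, List.In p l /\ P p n] -> exists p, List.In p l /\ U (P p).
Proof.
elim: l => [|q l IH] h.
  by have /(ultra_ex UU)[n [p []]] := h.
have [Uq|Uq] := ultraVC U UU (P q); first by exists q; split=> //; left.
suff /IH[p [pl Up]] : U [set n | exists p, List.In p l /\ P p n].
  by exists p; split=> //; right.
by apply: (ultraS UU _ (ultraI UU h Uq)) => n [[p [[<-|pl] Pp]] nq] //; exists p.
Qed.

(** For each [k] a finite net shows that almost all [u n] lie within [2 / k.+1] of one point [w k]
    of [K]; a subsequential limit of the [w k] is the ultralimit. *)
Lemma ultralimit_mcompact (K : set X) (u : nat -> X) : mcompact d K ->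
  U [set n | K (u n)] -> exists y, forall e, 0 < e -> U [set n | d (u n) y < e].
Proof.
move=> cK uK.
have H (k : nat) : exists w, K w /\ U [set n | d (u n) w < 2 / k.+1%:R].
  have k0 : 0 < 1 / k.+1%:R :> R by rewrite divr_gt0.
  have [l hl] := mcompact_net _ _ cK k0.
  have [|p [pl Up]] := @ultra_finite_union _ l (fun p n => d p (u n) < 1 / k.+1%:R).
    by apply: (ultraS UU _ uK) => n /hl[p hp]; exists p.
  have /(ultra_ex UU)[n [/= pn Kn]] := ultraI UU Up uK.
  exists (u n); split=> //; apply: (ultraS UU _ Up) => m /= pm.
  have := dtri d met (u m) p (u n); rewrite (dC d met _ p).
  move: pn pm; rewrite !div1r; set q := (_^-1); lra.
have [w Hw] := choice H.
have [phi [phiS [y [Ky cy]]]] := cK w (fun n => (Hw n).1).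
have phige n : (n <= phi n)%N.
  by elim: n => // n IH; apply: leq_ltn_trans IH (phiS n).
exists y => e e0.
have e2 : 0 < e / 2 by rewrite divr_gt0.
have [N hN] := cy _ e2.
have [M hM] : exists M : nat, 2 / M.+1%:R < e / 2.
  exists (Num.truncn (4 / e)); have e4 : 0 <= 4 / e by rewrite divr_ge0 // ltW.
  have /andP[_ h] := truncn_itv e4.
  rewrite ltr_pdivrMr //; move: h; rewrite ltr_pdivrMr //; lra.
pose k := maxn N M.
have h1 := hN k (leq_maxl _ _).
apply: (ultraS UU _ (Hw (phi k)).2) => n /= h2.
have h3 : 2 / (phi k).+1%:R <= 2 / M.+1%:R :> R.
  rewrite ler_pM2l // lef_pV2 ?posrE ?ltr0n // ler_nat ltnS.
  exact: leq_trans (leq_maxr _ _) (phige _).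
have h4 := lt_le_trans h2 (le_trans h3 (ltW hM)).
have := dtri d met (u n) (w (phi k)) y; move: h1 h4; clear; lra.
Qed.

Lemma ultralimit_real (u : nat -> R) (M : R) : (forall n, `|u n| <= M) ->
  exists l, forall e, 0 < e -> U [set n | `|u n - l| < e].
Proof.
move=> hM.
pose A := [set r : R | U [set n | r <= u n]].
have A0 : A !=set0.
  exists (- M); apply: (ultraS UU _ (UN 0)) => n _ /=.
  by have := hM n; rewrite ler_norml => /andP[].
have Aub : ubound A M.
  move=> r /(ultra_ex UU)[n /= h]; apply: le_trans h _.
  by have := hM n; rewrite ler_norml => /andP[].
have hs : has_sup A by split=> //; exists M.
exists (sup A) => e e0.
have [r Ar hr] := sup_adherent e0 hs.
have [bad|good] := ultraVC U UU [set n | sup A + e / 2 <= u n].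
  by have := ub_le_sup (ex_intro _ M Aub) bad; lra.
apply: (ultraS UU _ (ultraI UU Ar good)) => n [/= h1 /negP].
rewrite -ltNge => h2; rewrite ltr_norml; lra.
Qed.
End UltraLimits.

Section Lines.
Context {R : realType} {X : Type} (d : X -> X -> R) (delta : R).
Hypothesis met : is_metric d.
Hypothesis hyp : is_hyperbolic d delta.
Hypothesis geo : is_geodesic d.
Hypothesis prop : is_proper d.
Hypothesis delta0 : 0 <= delta.
Local Notation gp := (gprod d).

(** The line is the pointwise ultralimit of geodesics from [a n] to [b n], parametrised so that time
    0 is near [y]. An ultralimit sees only infinitely many indices, hence the form
    [exists n, (N <= n)%N] of the control on the ends; this suffices once [a] and [b] converge at
    infinity. *)
Lemma exists_line (y : X) (a b : nat -> X) (C : R) :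
  (forall n, gp y (a n) (b n) <= C) ->
  (forall r, exists N, forall n, (N <= n)%N -> r <= d y (a n)) ->
  (forall r, exists N, forall n, (N <= n)%N -> r <= d y (b n)) ->
  exists gam : R -> X, (forall s t, d (gam s) (gam t) = `|s - t|) /\
    d y (gam 0) <= C + 2 * delta + 1 /\
    (forall s (N : nat), 0 <= s -> exists n, (N <= n)%N /\
       s - (C + 2 * delta + 1) <= gp y (gam s) (b n)) /\
    (forall s (N : nat), 0 <= s -> exists n, (N <= n)%N /\
       s - (C + 2 * delta + 1) <= gp y (gam (- s)) (a n)).
Proof.
move=> hC ha hb.
have [U [UU UN]] := nonprincipal_ultrafilter.
have [g hg] := choice (fun n => geo (a n) (b n)).
pose e n := gp (a n) y (b n).
have he n : 0 <= e n <= d (a n) (b n) /\ d y (g n (e n)) <= C + 2 * delta.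
  have [h1 h2] := near_geod d delta met hyp (a n) (b n) (g n) y (hg n).
  by split=> //; apply: le_trans h2 _; have := hC n; lra.
(* The shifted time [s] falls inside the domain of the [n]-th geodesic; for fixed [s] this holds for
   all large [n], as both endpoints go to infinity. *)
pose valid s n := 0 <= e n + s <= d (a n) (b n).
have vU s : U [set n | valid s n].
  have [N1 h1] := ha (`|s| + C); have [N2 h2] := hb (`|s| + C).
  apply: (ultraS UU _ (ultraI UU (UN N1) (UN N2))) => n [/= /h1 k1 /h2 k2].
  have := hC n; rewrite /valid /e /gprod.
  rewrite (dC d met (a n) y).
  have := ler_norm s; have := ler_norm (- s); rewrite normrN.
  by move=> *; apply/andP; split; lra.
pose w s n := g n (e n + s).
have wd s t n : valid s n -> valid t n -> d (w s n) (w t n) = `|s - t|.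
  move=> hs ht; have [_ [_ ->//]] := hg n; congr (`| _ |); lra.
have v0 n : valid 0 n by rewrite /valid addr0; exact: (he n).1.
have hw0 n : d y (w 0 n) <= C + 2 * delta by rewrite /w addr0; exact: (he n).2.
have hw s n : valid s n -> d y (w s n) <= C + 2 * delta + `|s|.
  move=> hs; have := dtri d met y (w 0 n) (w s n).
  by rewrite wd // sub0r normrN; have := hw0 n; lra.
have hlim s : exists z, forall r, 0 < r -> U [set n | d (w s n) z < r].
  apply: (ultralimit_mcompact d met U UU _ _ (prop y (C + 2 * delta + `|s|))).
  by apply: (ultraS UU _ (vU s)) => n /= /hw.
have [gam hgam] := choice hlim.
have gamd s t : d (gam s) (gam t) = `|s - t|.
  apply/eqP/negP => /negP ne.
  have e0 : 0 < `|d (gam s) (gam t) - `|s - t| | / 2.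
    by rewrite divr_gt0 // normr_gt0 subr_eq0.
  have /(ultra_ex UU)[n [[/= h1 h2] [/= v1 v2]]] :=
    ultraI UU (ultraI UU (hgam s _ e0) (hgam t _ e0)) (ultraI UU (vU s) (vU t)).
  move: h1 h2; have := wd _ _ _ v1 v2.
  have := dtri d met (w s n) (gam s) (w t n).
  have := dtri d met (gam s) (gam t) (w t n).
  have := dtri d met (gam s) (w s n) (gam t).
  have := dtri d met (w s n) (w t n) (gam t).
  rewrite (dC d met (gam t) (w t n)) (dC d met (gam s) (w s n)).
  by case: (ger0P (d (gam s) (gam t) - `|s - t|)) => _; lra.
exists gam; split=> //; split; [|split].
- have /(ultra_ex UU)[n /= h] := hgam 0 1 ltr01.
  by have := dtri d met y (w 0 n) (gam 0); have := hw0 n; lra.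
- move=> s N s0.
  have [n [Nn [/= vn hn]]] := ultra_ex_ge U UU UN _ N (ultraI UU (vU s) (hgam s 1 ltr01)).
  exists n; split=> //.
  have := gp_lipl d met y (w s n) (gam s) (b n).
  have := gp_base d met (w 0 n) y (w s n) (b n); rewrite (dC d met _ y).
  have -> : gp (w 0 n) (w s n) (b n) = s.
    rewrite /gprod wd // sub0r normrN (ger0_norm s0).
    have [_ [e1 e2]] := hg n.
    have vl : 0 <= d (a n) (b n) <= d (a n) (b n) by rewrite lexx d_ge0.
    rewrite -{1 2}e1 /w !e2 ?[_ + 0]addr0 //; last by have := v0 n; rewrite /valid addr0.
    rewrite !(distrC _ (d _ _)) !ger0_norm; first lra.
      by case/andP: vn; lra.
    by have := v0 n; rewrite /valid addr0 => /andP[]; lra.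
  by have := hw0 n; lra.
- move=> s N s0.
  have [n [Nn [/= vn hn]]] := ultra_ex_ge U UU UN _ N (ultraI UU (vU (- s)) (hgam (- s) 1 ltr01)).
  exists n; split=> //.
  have := gp_lipl d met y (w (- s) n) (gam (- s)) (a n).
  have := gp_base d met (w 0 n) y (w (- s) n) (a n); rewrite (dC d met _ y).
  have -> : gp (w 0 n) (w (- s) n) (a n) = s.
    rewrite /gprod wd // sub0r opprK (ger0_norm s0).
    have [e1 [_ e2]] := hg n.
    have vl : 0 <= 0 :> R /\ 0 <= d (a n) (b n) by rewrite lexx d_ge0.
    rewrite -{1 2}e1 /w !e2 ?[_ + 0]addr0 ?subr0 //; try by rewrite vl.1 vl.2.
      by have := v0 n; rewrite /valid => /andP[? ?]; case/andP: vn => ? ?; rewrite !ger0_norm //; lra.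
    by have := v0 n; rewrite /valid addr0.
  by have := hw0 n; lra.
Qed.
End Lines.

(** * Boundary sequences and the orbit *)

Section Boundary.
Context {R : realType} {X : Type} (d : X -> X -> R) (delta : R) (x : X).
Hypothesis met : is_metric d.
Hypothesis hyp : is_hyperbolic d delta.
Local Notation gp := (gprod d).
Local Notation equiv := (seq_equiv d x).
Implicit Types (u v w : nat -> X) (p q : Bord d x).

Lemma seq_equiv_sym u v : equiv u v -> equiv v u.
Proof.
by move=> h r; have [N hN] := h r; exists N => n m nN mN; rewrite gpC //; apply: hN.
Qed.

Lemma seq_equiv_trans v u w : equiv u v -> equiv v w -> equiv u w.
Proof.
move=> h1 h2 r; have [N1 hN1] := h1 (r + delta); have [N2 hN2] := h2 (r + delta).
exists (maxn N1 N2) => n m; rewrite !geq_max => /andP[n1 n2] /andP[m1 m2].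
have k1 := hN1 n N1 n1 (leqnn _); have k2 := hN2 N1.
rewrite ltNge; apply/negP => h3.
have k3 := hN1 n (maxn N1 N2) n1 (leq_maxl _ _).
have k4 := hN2 (maxn N1 N2) m (leq_maxr _ _) m2.
have [t [t1 [t2 t3]]] : exists t, r + delta < t /\ t <= gp x (u n) (v (maxn N1 N2))
    /\ t <= gp x (v (maxn N1 N2)) (w m).
  exists (Num.min (gp x (u n) (v (maxn N1 N2))) (gp x (v (maxn N1 N2)) (w m))).
  by rewrite lt_min k3 k4 !ge_min !lexx orbT.
by have := hyp3 d delta hyp _ _ _ _ _ t2 t3; lra.
Qed.

Lemma seq_equiv_conv u v : equiv u v -> conv_inf d x u.
Proof. by move=> h; apply: seq_equiv_trans h (seq_equiv_sym _ _ h). Qed.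

Lemma seq_equiv_near u v v' C : (forall n, d (v n) (v' n) <= C) -> equiv u v -> equiv u v'.
Proof.
move=> hC h r; have [N hN] := h (r + C); exists N => n m nN mN.
have := hN n m nN mN; have := gp_lipr d met x (u n) (v m) (v' m).
by have := hC m; lra.
Qed.

Lemma seq_equiv_isom g u v : is_isometry d g -> equiv u v -> equiv (g \o u) (g \o v).
Proof.
move=> hg h r; have [N hN] := h (r + d (g x) x); exists N => n m nN mN /=.
have := hN n m nN mN; have := gp_base d met (g x) x (g (u n)) (g (v m)).
rewrite gp_isom //; lra.
Qed.

Lemma conv_inf_norm u : conv_inf d x u ->
  forall r, exists N, forall n, (N <= n)%N -> r <= d x (u n).
Proof.
move=> h r; have [N hN] := h r; exists N => n nN.
by have := hN n n nN nN; rewrite gpxx // => /ltW.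
Qed.

(** A single pair of late terms with a large product would, by hyperbolicity, force all late pairs
    to have a large product. *)
Lemma seq_equiv_boundedN u v : conv_inf d x u -> conv_inf d x v -> ~ equiv u v ->
  exists M N, forall n m, (N <= n)%N -> (N <= m)%N -> gp x (u n) (v m) <= M.
Proof.
move=> cu cv /existsNP[r /forallNP hr]; exists (r + 2 * delta).
have [N1 hN1] := cu (r + 2 * delta); have [N2 hN2] := cv (r + 2 * delta).
exists (maxn N1 N2) => n m; rewrite !geq_max => /andP[n1 n2] /andP[m1 m2].
rewrite leNgt; apply/negP => hb; apply: (hr (maxn N1 N2)) => i j.
rewrite !geq_max => /andP[i1 i2] /andP[j1 j2].
have k1 := hN1 i n i1 n1; have k2 := hN2 m j m2 j2.
pose t := Num.min (gp x (u i) (u n)) (Num.min (gp x (u n) (v m)) (gp x (v m) (v j))).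
have ht : r + 2 * delta < t by rewrite !lt_min k1 hb k2.
have t1 : t <= gp x (u i) (u n) by rewrite ge_min lexx.
have t2 : t <= gp x (u n) (v m) by rewrite !ge_min lexx orbT.
have t3 : t <= gp x (v m) (v j) by rewrite !ge_min lexx !orbT.
have h1 := hyp3 d delta hyp _ _ _ _ _ t1 t2.
(* Hyperbolicity at coinciding points gives [0 <= delta]. *)
have : t - delta <= gp x (v m) (v j).
  have := hyp x (u i) (u i) (u n); have := hyp x (u n) (u n) (u n).
  rewrite minxx; lra.
by move=> h2; have := hyp3 d delta hyp _ _ _ _ _ h1 h2; lra.
Qed.

Definition mkbd u (h : conv_inf d x u) : Bord d x :=
  exist (bvalid d x) (inr (bclass d x u)) (ex_intro _ u (conj h erefl)).

Lemma bd_rep p : is_bd p -> exists u, conv_inf d x u /\ seqs p = bclass d x u.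
Proof. by case: p => -[y//|C] hC _; case: (hC) => u [cu Cu]; exists u. Qed.

Lemma seqs_conv p u : is_bd p -> seqs p u -> conv_inf d x u.
Proof. by move=> /bd_rep[v [_ ->]] []. Qed.

Lemma seqs_equiv p u v : is_bd p -> seqs p u -> seqs p v -> equiv u v.
Proof.
move=> /bd_rep[w [_ ->]] [_ wu] [_ wv].
exact: seq_equiv_trans (seq_equiv_sym _ _ wu) wv.
Qed.

Lemma seqs_closed p u v : is_bd p -> seqs p u -> equiv u v -> seqs p v.
Proof.
move=> /bd_rep[w [_ ->]] [_ wu] uv; split.
  exact: seq_equiv_conv (seq_equiv_sym _ _ uv).
exact: seq_equiv_trans wu uv.
Qed.

Lemma bd_eq p q u v : is_bd p -> is_bd q -> seqs p u -> seqs q v -> equiv u v -> p = q.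
Proof.
move=> bp bq pu qv uv.
have e : seqs p = seqs q.
  apply/seteqP; split=> w hw.
    apply: (seqs_closed _ _ _ bq qv); apply: seq_equiv_trans (seq_equiv_sym _ _ uv) _.
    exact: seqs_equiv bp pu hw.
  by apply: (seqs_closed _ _ _ bp pu); apply: seq_equiv_trans uv _; apply: seqs_equiv bq qv hw.
clear -bp bq e; case: p q bp bq e => [[y|C] hC] [[z|C'] hC'] //= _ _.
rewrite /seqs /= => e; subst C'; congr exist; exact: Prop_irrelevance.
Qed.

Lemma seqs_ex p : exists u, seqs p u.
Proof.
case: p => -[y|C] hC; first by exists (fun=> y).
by case: (hC) => u [cu Cu]; exists u; rewrite /seqs /= Cu; split.
Qed.
End Boundary.

(** [D] comes from cocompactness, [2 * delta + 1] from [exists_line], and [3 * delta] from the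
    product of the two rays in [orbit_near_geodesic]. *)
Definition near_const {R : realType} (delta D : R) := D + 5 * delta + 1.
(** [2 * delta + 1] is the cost of [geodesic_projection], [near_const] that of moving the base point
    to the orbit, [2 * delta] that of [hyp4]; one [delta] is spare. *)
Definition branch_const {R : realType} (delta D : R) := near_const delta D + 5 * delta + 1.

(** * Geodesics between orbit points, and branching of the orbit *)

Section Orbit.
Context {R : realType} {X : Type} (d : X -> X -> R) (delta D : R) (x : X).
Context (G : set (X -> X)).
Hypothesis delta0 : 0 <= delta.
Hypothesis D0 : 0 <= D.
Hypothesis inM : in_M delta D d x G.
Local Notation gp := (gprod d).
Local Notation equiv := (seq_equiv d x).

Let met : is_metric d := inM.1.
Let prop : is_proper d := inM.2.1.
Let geo : is_geodesic d := inM.2.2.1.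
Let hyp : is_hyperbolic d delta := inM.2.2.2.1.
Let grp : is_isom_group d G := inM.2.2.2.2.1.
Let nonel : non_elementary d x G := inM.2.2.2.2.2.2.2.1.
Let coc : qc_cocompact d x G D := inM.2.2.2.2.2.2.2.2.1.
Let xhull : qc_hull d x (limit_set d x G) x := inM.2.2.2.2.2.2.2.2.2.

Local Notation C0 := (near_const delta D).

Lemma G_isom g : G g -> is_isometry d g.
Proof. exact: grp.1. Qed.
Lemma G_dist g a b : G g -> d (g a) (g b) = d a b.
Proof. by move=> /G_isom[]. Qed.
Lemma G_id : G id.
Proof. exact: grp.2.1. Qed.
Lemma G_comp g h : G g -> G h -> G (g \o h).
Proof. exact: grp.2.2.1. Qed.
Lemma G_inv g : G g -> exists h, G h /\ cancel g h /\ cancel h g.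
Proof.
move=> /(grp.2.2.2 _)[h [Gh [gh hg]]]; exists h; split=> //; split=> y.
  by move/(congr1 (fun f => f y)): hg.
by move/(congr1 (fun f => f y)): gh.
Qed.

(** Convergence to a limit point, expressed on sequences so that no boundary point has to be carried
    along. *)
Definition orbital (u : nat -> X) :=
  exists gs : nat -> X -> X, (forall n, G (gs n)) /\ equiv u (fun n => gs n x).

Lemma orbital_isom g u : G g -> orbital u -> orbital (g \o u).
Proof.
move=> Gg [gs [Ggs h]]; exists (fun n => g \o gs n); split.
  by move=> n; apply: G_comp.
exact: seq_equiv_isom (G_isom _ Gg) h.
Qed.

Lemma orbital_equiv u v : equiv u v -> orbital v -> orbital u.
Proof. by move=> uv [gs [Ggs h]]; exists gs; split=> //; apply: seq_equiv_trans uv h. Qed.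

Lemma hull_intro gam t : (forall s s', d (gam s) (gam s') = `|s - s'|) ->
  orbital (fun n => gam n%:R) -> orbital (fun n => gam (- n%:R)) ->
  qc_hull d x (limit_set d x G) (gam t).
Proof.
move=> gi h1 h2; exists gam; split=> //; split; last by exists t.
have mk u : orbital u -> exists p, limit_set d x G p /\ seqs p u.
  move=> [gs [Ggs h]].
  have cu : conv_inf d x u by apply: seq_equiv_conv h.
  exists (mkbd d x u cu); split; last by split.
  split=> //; exists gs; split=> //; split=> //.
  exact: seq_equiv_conv (seq_equiv_sym _ _ met _ _ h).
have [p [Lp pu]] := mk _ h1; have [q [Lq qu]] := mk _ h2.
by exists p, q.
Qed.

(** The base point lies on a line with both ends in the limit set. Points on opposite halves have
    product 0 at [x], so by hyperbolicity the two halves cannot both contain a point whose product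
    with [w] exceeds [delta]: one half points away from [w]. *)
Lemma hull_ray (w : X) : exists r : nat -> X,
  (forall n, d x (r n) = n%:R) /\ (forall n, gp x (r n) w <= delta) /\ orbital r.
Proof.
have [gam [gi [[p [q [Lp [Lq [pu qu]]]]] [t0 et]]]] := xhull.
have sub (sg : R) : `|sg| = 1 -> orbital (fun n => gam (sg * n%:R)) ->
    orbital (fun n => gam (t0 + sg * n%:R)).
  move=> sg1 [gs [Ggs h]]; exists gs; split=> //.
  apply: (seq_equiv_sym _ _ met).
  apply: (seq_equiv_near _ _ met _ (fun n => gam (sg * n%:R)) _ `|t0|).
    by move=> n; rewrite gi opprD addrCA subrr addr0 normrN.
  exact: (seq_equiv_sym _ _ met).
have orb p' u : limit_set d x G p' -> seqs p' u -> orbital u.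
  by move=> [bp' [gs [Ggs h]]] p'u; exists gs; split=> //; apply: seqs_equiv bp' p'u h.
have o1 : orbital (fun n => gam (t0 + 1 * n%:R)).
  by apply: sub; rewrite ?normr1 //; apply: (orb p) => //; under eq_fun do rewrite mul1r.
have o2 : orbital (fun n => gam (t0 + (-1) * n%:R)).
  by apply: sub; rewrite ?normrN1 //; apply: (orb q) => //; under eq_fun do rewrite mulN1r.
have ds (sg : R) n : `|sg| = 1 -> d x (gam (t0 + sg * n%:R)) = n%:R.
  by move=> sg1; rewrite -et gi opprD addNKr normrN normrM sg1 mul1r ger0_norm.
have [all1|/existsNP[n hn]] :=
    pselect (forall n : nat, gp x (gam (t0 + 1 * n%:R)) w <= delta).
  by exists (fun n => gam (t0 + 1 * n%:R)); split=> [n|//]; rewrite ds ?normr1.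
exists (fun n => gam (t0 + (-1) * n%:R)); split=> [n'|]; first by rewrite ds ?normrN1.
split=> // m; rewrite leNgt; apply/negP => hm.
move/negP: hn; rewrite -ltNge => hn.
pose t := Num.min (gp x (gam (t0 + 1 * n%:R)) w) (gp x (gam (t0 + -1 * m%:R)) w).
have ht : delta < t by rewrite lt_min hn hm.
have t1 : t <= gp x (gam (t0 + 1 * n%:R)) w by rewrite ge_min lexx.
have t2 : t <= gp x w (gam (t0 + -1 * m%:R)) by rewrite (gpC d met) ge_min lexx orbT.
have := hyp3 d delta hyp _ _ _ _ _ t1 t2.
rewrite {1}/gprod !ds ?normr1 ?normrN1 // gi.
have -> : t0 + 1 * n%:R - (t0 + -1 * m%:R) = n%:R + m%:R by lra.
rewrite ger0_norm; last by rewrite addr_ge0.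
lra.
Qed.

Lemma nat_unbounded (r : R) : exists N : nat, forall n, (N <= n)%N -> r <= n%:R.
Proof.
exists (Num.truncn `|r|).+1 => n hn; have /andP[_ h] := truncn_itv (normr_ge0 r).
apply: le_trans (ler_norm r) _; apply: le_trans (ltW h) _.
by rewrite ler_nat.
Qed.

(** Prolong the segment at both ends by rays that point away from it. The result is almost geodesic,
    so a line with ends in the limit set passes near [y]; it lies in the hull, and cocompactness
    brings an orbit point close to it. *)
Lemma orbit_near_geodesic g y : G g -> d x y + d y (g x) = d x (g x) ->
  exists k, G k /\ d (k x) y <= C0.
Proof.
move=> Gg hy.
have [small|big] := lerP (d x (g x)) (3 * delta).
  exists id; split; first exact: G_id.
  have := d_ge0 d met y (g x); rewrite /near_const /=; move: D0 delta0 hy small; lra.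
have [h [Gh [gh hg]]] := G_inv _ Gg.
have [r1 [r1d [r1w r1o]]] := hull_ray (g x).
(* The ray at [g x] is the image under [g] of a ray at [x] pointing away from [g^-1 x]. *)
have [r2' [r2d' [r2w' r2o']]] := hull_ray (h x).
pose r2 := g \o r2'.
have r2o : orbital r2 by apply: orbital_isom.
have r2d n : d (g x) (r2 n) = n%:R by rewrite /r2 /= G_dist.
have r2w n : gp (g x) (r2 n) x <= delta.
  by rewrite /r2 /= -{2}(hg x) gp_isom //; exact: G_isom.
have hC n : gp y (r1 n) (r2 n) <= 3 * delta.
  have e1 := gp_swap d met x (g x) (r2 n).
  have h1 : gp x (r1 n) (r2 n) <= 2 * delta.
    rewrite leNgt; apply/negP => hlt.
    pose t := Num.min (gp x (r1 n) (r2 n)) (d x (g x) - delta).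
    have ht : 2 * delta < t by rewrite lt_min hlt; lra.
    have t1 : t <= gp x (r1 n) (r2 n) by rewrite ge_min lexx.
    have t2 : t <= gp x (r2 n) (g x).
      apply: (@le_trans _ _ (d x (g x) - delta)); first by rewrite ge_min lexx orbT.
      by have := r2w n; rewrite (gpC d met (g x)) (gpC d met x (r2 n)); lra.
    by have := hyp3 d delta hyp _ _ _ _ _ t1 t2; have := r1w n; lra.
  have := r2w n; move: h1; rewrite /gprod r1d r2d (dC d met (g x) x) (dC d met (r2 n) x).
  have := dtri d met y x (r1 n); have := dtri d met y (g x) (r2 n).
  by rewrite r1d r2d (dC d met y x); lra.
have hr1 r : exists N, forall n, (N <= n)%N -> r <= d y (r1 n).
  have [N hN] := nat_unbounded (r + d x y); exists N => n /hN hn.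
  by have := dtri d met x y (r1 n); rewrite r1d; lra.
have hr2 r : exists N, forall n, (N <= n)%N -> r <= d y (r2 n).
  have [N hN] := nat_unbounded (r + d y (g x)); exists N => n /hN hn.
  by have := dtri d met (g x) y (r2 n); rewrite r2d (dC d met (g x) y); lra.
have [gam [gi [g0 [gb ga]]]] :=
  exists_line d delta met hyp geo prop y r1 r2 _ hC hr1 hr2.
(* The control on infinitely many indices is upgraded to equivalence with [u], since late terms of
   [u] have large mutual products. *)
have ends (sg : R) u : conv_inf d x u ->
    (forall s (N : nat), 0 <= s -> exists n, (N <= n)%N /\
       s - (3 * delta + 2 * delta + 1) <= gp y (gam (sg * s)) (u n)) ->
    equiv (fun n => gam (sg * n%:R)) u.
  move=> cu hu r.
  have [N1 hN1] := cu (r + delta).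
  have [N2 hN2] := nat_unbounded (r + delta + 1 + 5 * delta + 1 + d x y).
  exists (maxn N1 N2) => n m; rewrite !geq_max => /andP[n1 n2] /andP[m1 m2].
  have [k [kN hk]] := hu n%:R N1 (ler0n _ _).
  have k1 := hN1 k m kN m1; have k2 := hN2 _ n2.
  have k3 := gp_base d met y x (gam (sg * n%:R)) (u k).
  pose t := Num.min (r + delta + 1) (gp x (u k) (u m)).
  have ht : r + delta < t by rewrite lt_min k1 andbT; lra.
  have t2 : t <= gp x (u k) (u m) by rewrite ge_min lexx orbT.
  have t1 : t <= gp x (gam (sg * n%:R)) (u k).
    apply: (@le_trans _ _ (r + delta + 1)); first by rewrite ge_min lexx.
    by move: k3; rewrite (dC d met y x); lra.
  by have := hyp3 d delta hyp _ _ _ _ _ t1 t2; lra.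
have conv u : orbital u -> conv_inf d x u.
  by move=> [gs [_ uo]]; apply: seq_equiv_conv uo.
have e1 : orbital (fun n => gam n%:R).
  have c2 := conv _ r2o; apply: orbital_equiv r2o; have := ends 1 r2 c2.
  under eq_fun do rewrite mul1r; apply=> s N s0; rewrite mul1r; exact: gb.
have e2 : orbital (fun n => gam (- n%:R)).
  have c1 := conv _ r1o; apply: orbital_equiv r1o; have := ends (-1) r1 c1.
  under eq_fun do rewrite mulN1r; apply=> s N s0; rewrite mulN1r; exact: ga.
have [k [Gk hk]] := coc _ _ xhull (hull_intro _ 0 gi e1 e2).
exists k; split=> //; have := dtri d met (k x) (gam 0) y.
by rewrite (dC d met (gam 0) y) /near_const; lra.
Qed.

Lemma orbit_at g t : G g -> 0 <= t <= d x (g x) -> exists k, G k /\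
  t - C0 <= d x (k x) <= t + C0 /\ t - C0 <= gp x (k x) (g x).
Proof.
move=> Gg ht; have [y [y1 y2]] := geod_pt d met geo _ _ _ ht.
have [|k [Gk hk]] := orbit_near_geodesic g y Gg; first by rewrite y1 y2; lra.
exists k; split=> //.
have := dtri d met x y (k x); have := dtri d met x (k x) y.
have := dtri d met (k x) y (g x); rewrite /gprod (dC d met y (k x)).
by move=> *; split; [apply/andP; split|]; lra.
Qed.

(** No ray to [z] is needed: a late point of an orbit sequence converging to [z] is far enough for
    the segment leading to it to serve as one up to distance [t]. *)
Lemma orbit_toward z a t : limit_set d x G z -> seqs z a -> 0 <= t ->
  exists k, G k /\ t - C0 <= d x (k x) <= t + C0 /\
    exists N, forall n, (N <= n)%N -> t - C0 - delta <= gp x (k x) (a n).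
Proof.
move=> [bz [gs [Ggs zgs]]] za t0.
have [N hN] := seqs_equiv d delta x met hyp _ _ _ bz zgs za t.
have h1 := hN N N (leqnn _) (leqnn _).
have ht : 0 <= t <= d x (gs N x).
  by rewrite t0 /=; have := gp_lel d met x (gs N x) (a N); lra.
have [k [Gk [k1 k2]]] := orbit_at _ _ (Ggs N) ht.
exists k; split=> //; split=> //; exists N => n hn.
apply: (hyp3 d delta hyp _ _ _ _ _ k2).
by have := hN N n (leqnn _) hn; rewrite /near_const; have := D0; have := delta0; lra.
Qed.

(** [y] is an almost nearest point to [e] on a geodesic, the [1] being the slack in the infimum. If
    [e] shared a longer stretch with [a] or [b] as seen from [y], moving along that stretch would
    shorten the distance to [e] by more than [1]. *)
Lemma geodesic_projection a b e : exists y, d a y + d y b = d a b /\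
  gp y e a <= 2 * delta + 1 /\ gp y e b <= 2 * delta + 1.
Proof.
have [g [g0 [g1 gi]]] := geo a b.
pose A := [set r | exists t, 0 <= t <= d a b /\ r = d e (g t)].
have v0 : 0 <= (0 : R) <= d a b by rewrite lexx d_ge0.
have v1 : 0 <= d a b <= d a b by rewrite lexx d_ge0.
have hA : has_inf A.
  split; first by exists (d e (g 0)), 0.
  by exists 0 => r [t [_ ->]]; apply: d_ge0.
have [_ [t [ht ->]] hlt] := inf_adherent ltr01 hA.
have hmin s : 0 <= s <= d a b -> d e (g t) <= d e (g s) + 1.
  move=> hs; have : inf A <= d e (g s) by apply: ge_inf; [exact: hA.2|exists s].
  by move: hlt; lra.
case/andP: (ht) => t1 t2.
have dga s : 0 <= s <= d a b -> d a (g s) = s.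
  by move=> hs; rewrite -{1}g0 gi // sub0r normrN ger0_norm //; case/andP: hs.
have dgb s : 0 <= s <= d a b -> d (g s) b = d a b - s.
  by move=> hs; rewrite -{1}g1 gi // distrC ger0_norm // subr_ge0; case/andP: hs.
have dy1 := dga _ ht; have dy2 := dgb _ ht.
exists (g t); split; first by rewrite dy1 dy2; lra.
have key s c : 0 <= s <= d a b -> d (g t) (g s) = gp (g t) e c ->
    gp (g t) (g s) c = gp (g t) e c -> gp (g t) e c <= 2 * delta + 1.
  move=> hs e1 e2; have := hmin s hs.
  have h2 : gp (g t) e c <= gp (g t) c (g s) by rewrite (gpC d met _ c) e2.
  have := hyp3 d delta hyp _ _ _ _ _ (lexx _) h2.
  by rewrite {2}/gprod e1 (dC d met e (g t)); lra.
split.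
- have r1 : 0 <= gp (g t) e a <= t.
    by rewrite gp_ge0 //= -[leRHS]dy1 (dC d met a) gp_ler.
  have hs : 0 <= t - gp (g t) e a <= d a b by move: r1 => /andP[? ?]; apply/andP; split; lra.
  case/andP: (r1) => r2 r3.
  have e1 : d (g t) (g (t - gp (g t) e a)) = gp (g t) e a.
    by rewrite gi // opprB addrC subrK ger0_norm.
  apply: (key _ a hs e1); rewrite {1}/gprod e1 (dC d met _ a) dy1 (dC d met _ a) dga //.
  by lra.
- have r1 : 0 <= gp (g t) e b <= d a b - t.
    by rewrite gp_ge0 //= -[leRHS]dy2 gp_ler.
  have hs : 0 <= t + gp (g t) e b <= d a b by move: r1 => /andP[? ?]; apply/andP; split; lra.
  case/andP: (r1) => r2 r3.
  have e1 : d (g t) (g (t + gp (g t) e b)) = gp (g t) e b.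
    by rewrite gi // opprD addNKr normrN ger0_norm.
  by apply: (key _ b hs e1); rewrite {1}/gprod e1 dy2 dgb //; lra.
Qed.

Local Notation K1 := (branch_const delta D).

Lemma limit_orbits_three : exists a b e : nat -> X -> X,
  (forall n, G (a n) /\ G (b n) /\ G (e n)) /\
  conv_inf d x (fun n => a n x) /\ conv_inf d x (fun n => b n x) /\
  conv_inf d x (fun n => e n x) /\ ~ equiv (fun n => a n x) (fun n => b n x) /\
  ~ equiv (fun n => a n x) (fun n => e n x) /\ ~ equiv (fun n => b n x) (fun n => e n x).
Proof.
have other p q : exists r, limit_set d x G r /\ r <> p /\ r <> q.
  apply: contrapT => /forallNP h; apply: nonel; exists p, q => r Lr.
  have [?|ne1] := pselect (r = p); first by left.
  have [?|ne2] := pselect (r = q); first by right.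
  by have := h r; case; split.
(* The point [bpt d x x] is a dummy; only the existence of some limit point is wanted here. *)
have [p1 [L1 _]] := other (bpt d x x) (bpt d x x).
have [p2 [L2 [n12 _]]] := other p1 p1.
have [p3 [L3 [n13 n23]]] := other p1 p2.
have [b1 [a [Ga sa]]] := L1; have [b2 [b [Gb sb]]] := L2; have [b3 [e [Ge se]]] := L3.
have ne (p q : Bord d x) u v : is_bd p -> is_bd q -> seqs p u -> seqs q v -> q <> p -> ~ equiv u v.
  by move=> bp bq pu qv qp uv; apply: qp; apply/esym; apply: (bd_eq d delta x met hyp _ _ u v bp bq pu qv uv).
exists a, b, e; split=> //; 
split; first exact: seqs_conv b1 sa.
split; first exact: seqs_conv b2 sb.
split; first exact: seqs_conv b3 se.
split; first exact: (ne p1 p2); split; first exact: (ne p1 p3).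
exact: (ne p2 p3).
Qed.

(** Three orbit sequences with distinct limits span triangles with a coarse centre [y]. This centre
    is near the orbit, so a group element moves it near [x], and the three vertices are then seen
    from [x] in separate directions at a cost depending on [delta] and [D] only. Cutting down to
    distance [t] keeps this separation. *)
Lemma orbit_branching t : K1 + C0 < t -> exists g1 g2 g3,
  (G g1 /\ G g2 /\ G g3) /\
  (d x (g1 x) <= t + C0 /\ d x (g2 x) <= t + C0 /\ d x (g3 x) <= t + C0) /\
  (t - C0 <= d x (g1 x) /\ t - C0 <= d x (g2 x) /\ t - C0 <= d x (g3 x)) /\
  gp x (g1 x) (g2 x) <= K1 /\ gp x (g1 x) (g3 x) <= K1 /\ gp x (g2 x) (g3 x) <= K1.
Proof.
move=> ht.
have [a [b [e [Gs [ca [cb [ce [nab [nae nbe]]]]]]]]] := limit_orbits_three.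
have [M1 [N1 h1]] := seq_equiv_boundedN d delta x hyp _ _ ca cb nab.
have [M2 [N2 h2]] := seq_equiv_boundedN d delta x hyp _ _ ca ce nae.
have [M3 [N3 h3]] := seq_equiv_boundedN d delta x hyp _ _ cb ce nbe.
pose M := Num.max M1 (Num.max M2 M3).
(* Large enough that the vertices are still at distance [t] from [x] after the centre has been moved
   there; [M + 6 * delta + 4] bounds [d x y]. *)
pose B := t + M + 6 * delta + 4 + C0.
have [N4 h4] := conv_inf_norm d x met _ ca B.
have [N5 h5] := conv_inf_norm d x met _ cb B.
have [N6 h6] := conv_inf_norm d x met _ ce B.
pose n := (N1 + (N2 + (N3 + (N4 + (N5 + N6)))))%N.
have [Ga [Gb Ge]] := Gs n.
have n1 : (N1 <= n)%N by rewrite /n leq_addr.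
have n2 : (N2 <= n)%N by rewrite /n; lia.
have n3 : (N3 <= n)%N by rewrite /n; lia.
have {}h1 : gp x (a n x) (b n x) <= M.
  by apply: le_trans (h1 n n n1 n1) _; rewrite le_max lexx.
have {}h2 : gp x (a n x) (e n x) <= M.
  by apply: le_trans (h2 n n n2 n2) _; rewrite !le_max lexx orbT.
have {}h3 : gp x (b n x) (e n x) <= M.
  by apply: le_trans (h3 n n n3 n3) _; rewrite !le_max lexx !orbT.
have {}h4 : B <= d x (a n x) by apply: h4; rewrite /n; lia.
have {}h5 : B <= d x (b n x) by apply: h5; rewrite /n; lia.
have {}h6 : B <= d x (e n x) by apply: h6; rewrite /n; lia.
have [y [hy [py1 py2]]] := geodesic_projection (a n x) (b n x) (e n x).
have py0 : gp y (a n x) (b n x) = 0 by rewrite /gprod -hy (dC d met y (a n x)); lra.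
have [h [Gh [ah ha]]] := G_inv _ Ga.
(* [orbit_near_geodesic] wants a segment starting at [x], so the side from [a n x] to [b n x] is
   pulled back by the inverse of [a n]. *)
have [|k' [Gk' hk']] := orbit_near_geodesic (h \o b n) (h y) (G_comp _ _ Gh Gb).
  by rewrite /= -{1 3}(ah x) !(G_dist h).
pose k := a n \o k'.
have hk : d (k x) y <= C0.
  by rewrite /k /= -(ha y) (G_dist (a n)).
have Gk : G k by apply: G_comp.
have two P Q : gp y P x < 3 * delta + 2 -> gp y Q x < 3 * delta + 2 ->
    gp x P Q <= M -> d x y <= M + 6 * delta + 4.
  rewrite /gprod (dC d met y x) (dC d met P x) (dC d met Q x).
  have := dtri d met P y Q; rewrite (dC d met P y); lra.
have pair P Q : gp y P Q <= 2 * delta + 1 ->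
    gp y P x < 3 * delta + 2 \/ gp y Q x < 3 * delta + 2.
  move=> hPQ; rewrite (gpC d met y Q).
  by apply: (hyp3_or d delta hyp); lra.
(* Seen from [y], the base point can lie in the direction of at most one vertex; the other two have
   product at most [M] at [x], which confines [y]. *)
have hxy : d x y <= M + 6 * delta + 4.
  have qAB : gp y (a n x) (b n x) <= 2 * delta + 1 by rewrite py0; move: delta0; lra.
  have [sA|sB] := pair _ _ qAB; have [sE|sA'] := pair _ _ py1.
  - exact: (two _ _ sA sE h2).
  - have [sE|sB] := pair _ _ py2; first exact: (two _ _ sA sE h2).
    exact: (two _ _ sA sB h1).
  - exact: (two _ _ sB sE h3).
  - exact: (two _ _ sA' sB h1).
have [l [Gl [kl lk]]] := G_inv _ Gk.
have far c : G c -> B <= d x (c x) -> t <= d x ((l \o c) x).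
  move=> Gc hB; rewrite /= -{1}(kl x) (G_dist l) //.
  have := dtri d met x y (c x); have := dtri d met y (k x) (c x).
  by rewrite (dC d met y (k x)); move: hB; rewrite /B; lra.
have prodl P Q : gp y P Q <= 2 * delta + 1 -> gp x (l P) (l Q) <= 2 * delta + 1 + C0.
  move=> hPQ; rewrite -{1}(kl x) gp_isom; last exact: G_isom.
  by have := gp_base d met (k x) y P Q; lra.
have t0 : 0 <= t by move: ht D0 delta0; rewrite /branch_const /near_const; lra.
have at_t c : G c -> B <= d x (c x) -> exists k, G k /\
    t - C0 <= d x (k x) <= t + C0 /\ t - C0 <= gp x (k x) (l (c x)).
  move=> Gc hB; apply: (orbit_at (l \o c)); first exact: G_comp.
  by rewrite t0 far.
have [g1 [Gg1 [/andP[a1 b1] p1]]] := at_t _ Ga h4.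
have [g2 [Gg2 [/andP[a2 b2] p2]]] := at_t _ Gb h5.
have [g3 [Gg3 [/andP[a3 b3] p3]]] := at_t _ Ge h6.
have close P Q P' Q' : gp y P Q <= 2 * delta + 1 -> t - C0 <= gp x P' (l P) ->
    t - C0 <= gp x Q' (l Q) -> gp x P' Q' <= K1.
  move=> hPQ hP hQ; rewrite leNgt; apply/negP => hlt.
  pose r := Num.min (gp x P' Q') (t - C0).
  have hr : K1 < r by rewrite lt_min hlt; move: ht; lra.
  have r1 : r <= gp x P' Q' by rewrite ge_min lexx.
  have r2 : r <= gp x (l P) P'.
    by rewrite (gpC d met); apply: le_trans hP; rewrite ge_min lexx orbT.
  have r3 : r <= gp x Q' (l Q) by apply: le_trans hQ; rewrite ge_min lexx orbT.
  have := hyp4 d delta hyp delta0 _ _ _ _ _ _ r2 r1 r3.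
  by have := prodl _ _ hPQ; move: hr delta0; rewrite /branch_const; lra.
exists g1, g2, g3; do 3!split=> //.
by split; [apply: (close (a n x) (b n x))|split;
  [apply: (close (a n x) (e n x))|apply: (close (b n x) (e n x))]] => //;
  rewrite ?py0 ?(gpC d met y _ (e n x)) //; move: delta0; lra.
Qed.
End Orbit.

(** * Orbital sums *)

Section Esum.
Context {R : realType}.

Lemma esum_subset {T : choiceType} (U V : set T) (a : T -> \bar R) :
  U `<=` V -> (forall i, (0 <= a i)%E) ->
  (\esum_(i in U) a i <= \esum_(i in V) a i)%E.
Proof.
move=> UV a0; rewrite (esumID U V) //.
have -> : V `&` U = U by apply/setIidPr.
by rewrite leeDl // esum_ge0.
Qed.

Lemma esumZl_le {T : choiceType} (U : set T) (c : R) (a : T -> \bar R) :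
  0 <= c -> (forall i, (0 <= a i)%E) ->
  (\esum_(i in U) (c%:E * a i) <= c%:E * \esum_(i in U) a i)%E.
Proof.
move=> c0 a0; apply: ge_ereal_sup => _ [A [fA AU] <-].
rewrite -ge0_mule_fsumr //; apply: lee_wpmul2l; first by rewrite lee_fin.
by apply: ereal_sup_ubound; exists A.
Qed.

Lemma esum_le_inj {T T' : choiceType} (U : set T) (W : set T') (f : T -> T') (c : R)
    (a : T -> \bar R) (b : T' -> \bar R) :
  0 <= c -> (forall j, (0 <= b j)%E) ->
  set_inj U f -> (forall i, U i -> W (f i) /\ (a i <= c%:E * b (f i))%E) ->
  (\esum_(i in U) a i <= c%:E * \esum_(j in W) b j)%E.
Proof.
move=> c0 b0 fi h; apply: (@le_trans _ _ (\esum_(i in U) (c%:E * b (f i)))%E).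
  by apply: le_esum => i /h[].
apply: (le_trans (esumZl_le _ _ _ c0 _)) => //.
apply: lee_wpmul2l; first by rewrite lee_fin.
rewrite -esum_image //; apply: esum_subset => // j [i Ui <-].
by have [] := h i Ui.
Qed.

(** Submultiplicativity: a choice of factors [k], [v] for each [u] is automatically injective
    because [op] recovers [u]. *)
Lemma esum_le_prod {T T1 T2 : choiceType} (k0 : T1) (v0 : T2) (U : set T) (A : set T1)
    (W : set T2) (op : T1 -> T2 -> T) (c : R) (a : T -> \bar R) (b1 : T1 -> R) (b2 : T2 -> R) :
  0 <= c -> (forall k, 0 <= b1 k) -> (forall v, 0 <= b2 v) ->
  (forall u, U u -> exists k v, [/\ A k, W v, op k v = u &
     (a u <= (c * (b1 k * b2 v))%:E)%E]) ->
  (\esum_(v in W) (b2 v)%:E < +oo)%E ->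
  (\esum_(u in U) a u <=
    c%:E * ((\esum_(v in W) (b2 v)%:E) * (\esum_(k in A) (b1 k)%:E)))%E.
Proof.
move=> c0 b10 b20 h Wfin.
(* Outside [U] the pair [(k0, v0)] is a default value, making the choice total. *)
have h' u : exists kv : T1 * T2, U u -> [/\ A kv.1, W kv.2, op kv.1 kv.2 = u &
     (a u <= (c * (b1 kv.1 * b2 kv.2))%:E)%E].
  have [Uu|nUu] := pselect (U u); last by exists (k0, v0).
  by have [k [v hkv]] := h u Uu; exists (k, v).
have [f hf] := choice h'.
have fi : set_inj U f.
  move=> u u' /set_mem Uu /set_mem Uu' e.
  by have [_ _ <- _] := hf u Uu; have [_ _ <- _] := hf u' Uu'; rewrite e.
apply: (@le_trans _ _ (c%:E * \esum_(p in A `*`` (fun=> W)) (b1 p.1 * b2 p.2)%:E)%E).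
  apply: (esum_le_inj _ _ f) => //.
    by move=> p; rewrite lee_fin mulr_ge0.
  by move=> u Uu; have [Ak Wv _ hu] := hf u Uu; rewrite -EFinM.
apply: lee_wpmul2l; first by rewrite lee_fin.
rewrite -(@esum_esum _ _ _ A (fun=> W) (fun k v => (b1 k * b2 v)%:E)); last first.
  by move=> k v _ _; rewrite lee_fin mulr_ge0.
have W0 : (0 <= \esum_(v in W) (b2 v)%:E)%E by apply: esum_ge0 => v _; rewrite lee_fin.
have [r r0 Wr] : exists2 r, 0 <= r & (\esum_(v in W) (b2 v)%:E = r%:E)%E.
  exists (fine (\esum_(v in W) (b2 v)%:E)); first exact: fine_ge0.
  by rewrite fineK // ge0_fin_numE.
apply: (@le_trans _ _ (\esum_(k in A) (r%:E * (b1 k)%:E))%E).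
  apply: le_esum => k _; rewrite muleC -Wr.
  apply: (@le_trans _ _ (\esum_(v in W) ((b1 k)%:E * (b2 v)%:E))%E).
    by apply: le_esum => v _; rewrite EFinM.
  by apply: esumZl_le => // v; rewrite lee_fin.
by rewrite Wr; apply: esumZl_le => // k; rewrite lee_fin.
Qed.
End Esum.

Lemma finite_set_bounded {R : realType} {T : choiceType} (F : set T) (l : T -> R) :
  finite_set F -> exists M, forall u, F u -> l u <= M.
Proof.
move=> /finite_seqP[A ->]; exists (\sum_(u <- A) `|l u|) => u /= uA.
rewrite (big_rem u) //=; apply: le_trans (ler_norm _) _.
by rewrite lerDl sumr_ge0.
Qed.

(** Arithmetic core of the three-cone argument, with [p_i = lam * m_i] for masses [m_i]. Every [m_i]
    is at least the sum of the two smallest [p]; adding this over the two smaller masses contradicts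
    [m_i < 2 * p_i]. *)
Lemma no_three_halves {R : realFieldType} (m1 m2 m3 p1 p2 p3 : R) :
  [\/ p1 + p2 <= m1, p1 + p3 <= m1 | p2 + p3 <= m1] ->
  [\/ p1 + p2 <= m2, p1 + p3 <= m2 | p2 + p3 <= m2] ->
  [\/ p1 + p2 <= m3, p1 + p3 <= m3 | p2 + p3 <= m3] ->
  (m1 <= m2 -> p1 <= p2) -> (m2 <= m1 -> p2 <= p1) ->
  (m1 <= m3 -> p1 <= p3) -> (m3 <= m1 -> p3 <= p1) ->
  (m2 <= m3 -> p2 <= p3) -> (m3 <= m2 -> p3 <= p2) ->
  m3 / 2 < p3 -> m2 / 2 < p2 -> m1 / 2 < p1 -> False.
Proof.
have smallest (a b c m : R) : a <= c -> b <= c ->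
    [\/ a + b <= m, a + c <= m | b + c <= m] -> a + b <= m.
  by move=> ac bc []; lra.
have perm (P Q S : Prop) : [\/ P, Q | S] -> [\/ Q, P | S].
  by case; [apply: Or32|apply: Or31|apply: Or33].
have perm' (P Q S : Prop) : [\/ P, Q | S] -> [\/ S, P | Q].
  by case; [apply: Or32|apply: Or33|apply: Or31].
move=> h1 h2 h3 c12 c21 c13 c31 c23 c32 k3 k2 k1.
have [o13|/ltW/c31 o13] := lerP m1 m3; have [o23|/ltW/c32 o23] := lerP m2 m3.
- have {}o13 := c13 o13; have {}o23 := c23 o23.
  have := smallest _ _ _ _ o13 o23 h1; have := smallest _ _ _ _ o13 o23 h2; lra.
- have := le_trans (c13 o13) o23 => o12.
  move/perm : h1; move/perm : h3; rewrite ![p2 + p3]addrC => h3 h1.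
  have := smallest _ _ _ _ o12 o23 h1; have := smallest _ _ _ _ o12 o23 h3; lra.
- have := le_trans (c23 o23) o13 => o21.
  move/perm' : h2; move/perm' : h3; rewrite ![p1 + p2]addrC ![p1 + p3]addrC => h3 h2.
  have := smallest _ _ _ _ o21 o13 h2; have := smallest _ _ _ _ o21 o13 h3; lra.
- have [o12|/ltW/c21 o12] := lerP m1 m2.
    have {}o12 := c12 o12.
    move/perm : h1; move/perm : h3; rewrite ![p2 + p3]addrC => h3 h1.
    have := smallest _ _ _ _ o12 o23 h1; have := smallest _ _ _ _ o12 o23 h3; lra.
  move/perm' : h2; move/perm' : h3; rewrite ![p1 + p2]addrC ![p1 + p3]addrC => h3 h2.
  have := smallest _ _ _ _ o12 o13 h2; have := smallest _ _ _ _ o12 o13 h3; lra.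
Qed.

(** * Shadows and cones in the orbit *)

Section OrbitSums.
Context {R : realType} {X : Type} (d : X -> X -> R) (delta D : R) (x : X).
Context (G : set (X -> X)).
Hypothesis delta0 : 0 <= delta.
Hypothesis D0 : 0 <= D.
Hypothesis inM : in_M delta D d x G.
Local Notation gp := (gprod d).
Local Notation C0 := (near_const delta D).
Local Notation K1 := (branch_const delta D).
Local Notation len g := (d x (g x)).
Let met : is_metric d := inM.1.
Let hyp : is_hyperbolic d delta := inM.2.2.2.1.

Definition orbit_sum (s : R) (U : set (X -> X)) : \bar R :=
  \esum_(g in (G `&` U : set {classic (X -> X)})) (expR (- (s * len g)))%:E.

Lemma orbit_sumT s : orbit_sum s setT = poincare d x G s.
Proof. by rewrite /orbit_sum setIT. Qed.

Lemma expE_ge0 (r : R) : (0 <= (expR r)%:E)%E.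
Proof. by rewrite lee_fin expR_ge0. Qed.

Lemma orbit_sum_ge0 s U : (0 <= orbit_sum s U)%E.
Proof. by apply: esum_ge0 => g _; exact: expE_ge0. Qed.

Lemma orbit_sum_mono s U V : (forall g, G g -> U g -> V g) -> (orbit_sum s U <= orbit_sum s V)%E.
Proof.
move=> h; apply: esum_subset => [g [Gg Ug]|g]; last exact: expE_ge0.
by split=> //; apply: h.
Qed.

Lemma orbit_sum_split s U V : orbit_sum s U = (orbit_sum s (U `&` V) + orbit_sum s (U `&` ~` V))%E.
Proof.
rewrite /orbit_sum (esumID (V : set {classic (X -> X)}) (G `&` U : set {classic (X -> X)})).
  by rewrite !setIA.
by move=> g _; exact: expE_ge0.
Qed.

(** Two exponents are allowed so that [h = id] also compares the series at different exponents on a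
    bounded set. *)
Lemma orbit_sum_translate s s' h U W c : G h ->
  (forall u, G u -> U u -> W (h \o u) /\ - (s * len u) <= c - s' * len (h \o u)) ->
  (orbit_sum s U <= (expR c)%:E * orbit_sum s' W)%E.
Proof.
move=> Gh hU; apply: (@esum_le_inj R {classic (X -> X)} {classic (X -> X)} (G `&` U) (G `&` W)
  (fun u => h \o u)).
- exact: expR_ge0.
- by move=> g; exact: expE_ge0.
- move=> u v _ _ e; have [k [_ [hk _]]] := G_inv d delta D x G inM _ Gh.
  by apply: funext => y; have := congr1 (fun f => k (f y)) e; rewrite /= !hk.
- move=> u [Gu Uu]; have [Wu le] := hU u Gu Uu; split.
    by split=> //; apply: G_comp inM _ _ Gh Gu.
  by rewrite -EFinM lee_fin -expRD ler_expR.
Qed.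

Section FiniteSum.
Context (s : R).
Hypothesis s0 : 0 <= s.
Hypothesis sfin : (orbit_sum s setT < +oo)%E.

Definition orbit_sumr U := fine (orbit_sum s U).

Lemma orbit_sum_fin U : orbit_sum s U = (orbit_sumr U)%:E.
Proof.
rewrite /orbit_sumr fineK // ge0_fin_numE ?orbit_sum_ge0 //.
by apply: le_lt_trans sfin; apply: orbit_sum_mono.
Qed.

Lemma orbit_sumr_ge0 U : 0 <= orbit_sumr U.
Proof. by rewrite -lee_fin -orbit_sum_fin orbit_sum_ge0. Qed.

Lemma orbit_sumr_mono U V : (forall g, G g -> U g -> V g) -> orbit_sumr U <= orbit_sumr V.
Proof. by move=> h; rewrite -lee_fin -!orbit_sum_fin orbit_sum_mono. Qed.

Lemma orbit_sumr_split U V : orbit_sumr U = orbit_sumr (U `&` V) + orbit_sumr (U `&` ~` V).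
Proof. by apply: EFin_inj; rewrite EFinD -!orbit_sum_fin -orbit_sum_split. Qed.

Lemma orbit_sumr_translate h U W c : G h ->
  (forall u, G u -> U u -> W (h \o u) /\ - (s * len u) <= c - s * len (h \o u)) ->
  orbit_sumr U <= expR c * orbit_sumr W.
Proof.
by move=> Gh hU; rewrite -lee_fin EFinM -!orbit_sum_fin; exact: (orbit_sum_translate _ _ h).
Qed.

Lemma orbit_sumr_gt0 U g : G g -> U g -> 0 < orbit_sumr U.
Proof.
move=> Gg Ug; rewrite -lte_fin -orbit_sum_fin.
apply: (@lt_le_trans _ _ (\esum_(u in ([set g] : set {classic (X -> X)})) (expR (- (s * len u)))%:E)%E).
  by rewrite esum_set1 ?lte_fin ?expR_gt0 // expE_ge0.
apply: esum_subset => [u eu|u]; last exact: expE_ge0.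
by rewrite eu; split.
Qed.

(** By [gp_swap] the condition says that the product of [x] and [u x] at [g x] is at most [K]: a
    geodesic from [x] to [u x] passes near [g x]. *)
Definition shadow g (K : R) := [set u : X -> X | len g - K <= gp x (g x) (u x)].

(** On the shadow, [len u] is at least [len g + d (g x) (u x) - 2 * K], and [d (g x) (u x)] is the
    length of the translate by [g^-1]. *)
Lemma shadow_upper g K : G g ->
  orbit_sumr (shadow g K) <= expR (s * (2 * K - len g)) * orbit_sumr setT.
Proof.
move=> Gg; have [h [Gh [gh hg]]] := G_inv d delta D x G inM _ Gg.
apply: (orbit_sumr_translate h) => // u Gu; rewrite /shadow /= => hu; split=> //.
have -> : d x (h (u x)) = d (g x) (u x).
  by rewrite -{1}(gh x) (G_dist d delta D x G inM h).
rewrite lerBrDl -mulrN -mulrDr; apply: ler_wpM2l => //.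
by move: hu; rewrite /gprod; lra.
Qed.

(** Translating by [g_i] sends a cone into the cone over [g_i x] unless that cone meets the
    direction of [g_i^-1 x]. The cones are so far apart that this excludes at most one of the three,
    so each mass is at least [lam] times the sum of two of them, and [no_three_halves] bounds
    [lam]. *)
Lemma orbit_sumr_triple g1 g2 g3 (t : R) : G g1 -> G g2 -> G g3 ->
  len g1 <= t -> len g2 <= t -> len g3 <= t ->
  2 * (K1 + 3 * delta + 1) <= len g1 -> 2 * (K1 + 3 * delta + 1) <= len g2 ->
  2 * (K1 + 3 * delta + 1) <= len g3 ->
  gp x (g1 x) (g2 x) <= K1 -> gp x (g1 x) (g3 x) <= K1 -> gp x (g2 x) (g3 x) <= K1 ->
  expR (- (s * t)) <= 1 / 2.
Proof.
move=> G1 G2 G3 t1 t2 t3 l1 l2 l3 p12 p13 p23.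
have K10 : 0 <= K1 by move: D0 delta0; rewrite /branch_const /near_const; lra.
(* The margin [3 * delta + 1] absorbs the chained uses of hyperbolicity in [meet1]; lengths of at
   least [2 * K2] make [len g - K2] at least [K2]. *)
pose K2 := K1 + 3 * delta + 1.
pose cone g := [set u : X -> X | K2 <= gp x (g x) (u x)].
pose lam := expR (- (s * t)).
have main g g' g'' : G g -> len g <= t -> 2 * K2 <= len g -> G g' -> G g'' ->
    gp x (g' x) (g'' x) <= K1 ->
    (forall h, G h -> cancel g h -> cancel h g -> forall u, G u ->
      (cone g' u \/ cone g'' u) -> gp x (h x) (u x) <= len g - K2) ->
    lam * (orbit_sumr (cone g') + orbit_sumr (cone g'')) <= orbit_sumr (cone g).
  move=> Gg lt lg Gg' Gg'' pp dis.
  have [h [Gh [gh hg]]] := G_inv d delta D x G inM _ Gg.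
  have -> : orbit_sumr (cone g') + orbit_sumr (cone g'') = orbit_sumr (cone g' `|` cone g'').
    rewrite (orbit_sumr_split (cone g' `|` cone g'') (cone g')); congr (_ + _).
      by congr orbit_sumr; apply/seteqP; split=> u /=; [move=> hu; split=> //; left|case].
    congr orbit_sumr; apply/seteqP; split=> u /=; last by case=> [[|]].
    move=> hu''; split; first by right.
    move=> hu'; have := hyp3 d delta hyp x (g' x) (u x) (g'' x) K2 hu'.
    rewrite (gpC d met x (u x)) => /(_ hu''); rewrite /K2; move: pp delta0; lra.
  have : orbit_sumr (cone g' `|` cone g'') <= expR (s * t) * orbit_sumr (cone g).
    apply: (orbit_sumr_translate g) => // u Gu hu /=; split.
      have e : gp (g x) x (g (u x)) = gp x (h x) (u x).
        by rewrite -{2}(hg x) gp_isom //; exact: (G_isom d delta D x G inM).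
      have := dis h Gh gh hg u Gu hu; rewrite -e.
      by have := gp_swap d met x (g x) (g (u x)); rewrite /cone /=; lra.
    have := dtri d met x (g x) (g (u x)).
    rewrite (G_dist d delta D x G inM g) // => /(ler_wpM2l s0); rewrite mulrDr.
    by have := ler_wpM2l s0 lt; lra.
  move=> /(ler_wpM2l (expR_ge0 (- (s * t)))).
  by rewrite mulrA -expRD addNr expR0 mul1r.
have meet1 g g' g'' h u v : G g -> 2 * K2 <= len g -> G h -> cancel g h -> cancel h g ->
   gp x (g' x) (g'' x) <= K1 -> cone g' u -> cone g'' v ->
   gp x (h x) (u x) <= len g - K2 \/ gp x (h x) (v x) <= len g - K2.
  move=> Gg lg Gh gh hg pp hu hv.
  have [a|a] := lerP (gp x (h x) (u x)) (len g - K2); first by left.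
  have [b|b] := lerP (gp x (h x) (v x)) (len g - K2); first by right.
  have a' : K2 <= gp x (u x) (h x) by rewrite (gpC d met); lra.
  have b' : K2 <= gp x (h x) (v x) by lra.
  have c' : K2 - delta <= gp x (v x) (g'' x).
    by rewrite (gpC d met); move: hv; rewrite /cone /=; move: delta0; lra.
  have c := hyp3 d delta hyp _ _ _ _ _ (hyp3 d delta hyp _ _ _ _ _ hu a') 
     (le_trans _ b').
  have c1 : K2 - delta <= K2 by move: delta0; lra.
  have c2 := c c1.
  have c3 : K2 - delta - delta <= gp x (v x) (g'' x) by move: c' delta0; lra.
  have := hyp3 d delta hyp _ _ _ _ _ c2 c3; rewrite /K2; move: pp; lra.
have pick g : G g -> len g <= t -> 2 * K2 <= len g ->
    [\/ lam * (orbit_sumr (cone g1) + orbit_sumr (cone g2)) <= orbit_sumr (cone g),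
        lam * (orbit_sumr (cone g1) + orbit_sumr (cone g3)) <= orbit_sumr (cone g) |
        lam * (orbit_sumr (cone g2) + orbit_sumr (cone g3)) <= orbit_sumr (cone g)].
  move=> Gg lt lg.
  have [h [Gh [gh hg]]] := G_inv d delta D x G inM _ Gg.
  have uniqh h' : cancel g h' -> h' = h.
    by move=> gh'; apply: funext => y; rewrite -{1}(hg y) gh'.
  (* Some element of the cone over [g' x] looks towards [g^-1 x], so that translation by [g] could
     cancel too much length. *)
  pose bad g' := exists2 u, cone g' u & len g - K2 < gp x (h x) (u x).
  have good g' g'' : ~ bad g' -> ~ bad g'' -> forall h', G h' -> cancel g h' -> cancel h' g ->
     forall u, G u -> (cone g' u \/ cone g'' u) -> gp x (h' x) (u x) <= len g - K2.
    move=> b' b'' h' Gh' /uniqh -> _ u Gu [hu|hu]; rewrite leNgt; apply/negP => hlt.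
      by apply: b'; exists u.
    by apply: b''; exists u.
  have two g' g'' : gp x (g' x) (g'' x) <= K1 -> bad g' -> bad g'' -> False.
    move=> pp [u hu ku] [v hv kv].
    by have [] := meet1 _ _ _ _ _ _ Gg lg Gh gh hg pp hu hv; lra.
  have [b1|b1] := pselect (bad g1).
    by apply: Or33; apply: main => //; apply: good => b; [apply: (two g1 g2)|apply: (two g1 g3)].
  have [b2|b2] := pselect (bad g2).
    by apply: Or32; apply: main => //; apply: good => // b; apply: (two g2 g3).
  by apply: Or31; apply: main => //; apply: good.
have pos g : G g -> 2 * K2 <= len g -> 0 < orbit_sumr (cone g).
  move=> Gg lg; apply: (orbit_sumr_gt0 _ g) => //; rewrite /cone /= (gpxx d met).
  by move: lg delta0; rewrite /K2; lra.
have := pos _ G1 l1; have := pos _ G2 l2; have := pos _ G3 l3.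
have := pick _ G1 t1 l1; have := pick _ G2 t2 l2; have := pick _ G3 t3 l3.
rewrite -/lam; set m1 := orbit_sumr (cone g1); set m2 := orbit_sumr (cone g2); set m3 := orbit_sumr (cone g3).
rewrite !mulrDr => h3 h2 h1 m3p m2p m1p; rewrite leNgt; apply/negP => hlam.
have half m : 0 < m -> m / 2 < lam * m.
  by move=> m0; rewrite mulrC ltr_pM2r // -div1r.
have l0 : 0 <= lam by exact: expR_ge0.
have mon a b : a <= b -> lam * a <= lam * b by exact: ler_wpM2l.
have := half _ m1p; have := half _ m2p; have := half _ m3p.
move: h1 h2 h3 (mon m1 m2) (mon m2 m1) (mon m1 m3) (mon m3 m1) (mon m2 m3) (mon m3 m2).
exact: no_three_halves.
Qed.
End FiniteSum.
End OrbitSums.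

(** * The critical exponent *)

(** Upper bound for the lengths in [orbit_branching] when [t] is chosen so that the lower bound
    [t - C0] equals the [2 * K2] wanted by [orbit_sumr_triple]. *)
Definition growth_const {R : realType} (delta D : R) :=
  2 * (branch_const delta D + 3 * delta + 1) + 2 * near_const delta D.

Section CriticalExponent.
Context {R : realType} {X : Type} (d : X -> X -> R) (delta D : R) (x : X).
Context (G : set (X -> X)).
Hypothesis delta0 : 0 <= delta.
Hypothesis D0 : 0 <= D.
Hypothesis inM : in_M delta D d x G.
Local Notation gp := (gprod d).
Local Notation C0 := (near_const delta D).
Local Notation K1 := (branch_const delta D).
Local Notation L := (growth_const delta D).
Local Notation len g := (d x (g x)).
Local Notation psum := (orbit_sum d x G).
Let met : is_metric d := inM.1.
Let hyp : is_hyperbolic d delta := inM.2.2.2.1.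

Lemma near_const_ge1 : 1 <= C0.
Proof. by move: D0 delta0; rewrite /near_const; lra. Qed.

Lemma growth_const_gt0 : 0 < L.
Proof.
by move: near_const_ge1 delta0; rewrite /growth_const /branch_const; lra.
Qed.

Lemma convergent_exponent s : 0 <= s -> (psum s setT < +oo)%E -> expR (- (s * L)) <= 1 / 2.
Proof.
move=> s0 sfin; pose t := 2 * (K1 + 3 * delta + 1) + C0.
have ht : K1 + C0 < t.
  by move: near_const_ge1 delta0; rewrite /t /branch_const; lra.
have [g1 [g2 [g3 [[G1 [G2 G3]] [[u1 [u2 u3]] [[l1 [l2 l3]] [p12 [p13 p23]]]]]]]] :=
  orbit_branching d delta D x G delta0 D0 inM t ht.
have -> : L = t + C0 by rewrite /growth_const /t; lra.
by apply: (orbit_sumr_triple d delta D x G delta0 D0 inM s s0 sfin g1 g2 g3) => //;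
  rewrite /t in l1 l2 l3 *; lra.
Qed.

(* The complement of the shadow pulled back by [g^-1] lies in the shadow of an orbit point
   at distance about [K], which carries little mass as [s L >= ln 2]. *)
Lemma shadow_lower s S n g : 0 <= s <= S -> (psum s setT < +oo)%E ->
  expR (S * (4 * C0 + 2 * delta)) <= 2 ^+ n -> G g ->
  expR (- (s * len g)) / 2 * orbit_sumr d x G s setT <=
    orbit_sumr d x G s (shadow d x g (C0 + n.+1%:R * L)).
Proof.
move=> /andP[s0 sS] sfin hn Gg; set K := C0 + n.+1%:R * L.
have [h [Gh [gh hg]]] := G_inv d delta D x G inM _ Gg.
pose A := [set v : X -> X | gp x (h x) (v x) <= K].
have K0 : C0 <= K by rewrite /K lerDl mulr_ge0 // ltW // growth_const_gt0.
have hA : orbit_sumr d x G s A <= expR (s * len g) * orbit_sumr d x G s (shadow d x g K).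
  apply: (orbit_sumr_translate d delta D x G inM s sfin g) => // u Gu; rewrite /A /shadow /= => hu.
  have e : gp (g x) x (g (u x)) = gp x (h x) (u x).
    by rewrite -{2}(hg x) gp_isom //; exact: (G_isom d delta D x G inM).
  split; first by have := gp_swap d met x (g x) (g (u x)); lra.
  have := dtri d met x (g x) (g (u x)).
  by rewrite (G_dist d delta D x G inM g) // => /(ler_wpM2l s0); rewrite mulrDr; lra.
have hB : orbit_sumr d x G s (~` A) <= 1 / 2 * orbit_sumr d x G s setT.
  (* If [g^-1 x] is within [K] of [x], no product exceeds [K] and the complement of [A] is empty. *)
  have [small|big] := lerP (len h) K.
    apply: (@le_trans _ _ 0); last by rewrite mulr_ge0 ?orbit_sumr_ge0.
    have : (psum s (~` A) <= psum s set0)%E.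
      apply: orbit_sum_mono => u Gu; rewrite /A /= => hu; apply: hu.
      exact: le_trans (gp_lel d met _ _ _) small.
    rewrite /orbit_sumr {2}/orbit_sum setI0 esum_set0 => le0.
    by rewrite (_ : psum s (~` A) = 0%E) //; apply/le_anti; rewrite le0 orbit_sum_ge0.
  have hK : 0 <= K <= len h.
    by rewrite (ltW big) andbT; apply: le_trans K0; move: near_const_ge1; lra.
  have [k [Gk [/andP[k1 k3] k2]]] := orbit_at d delta D x G delta0 D0 inM h K Gh hK.
  apply: (@le_trans _ _ (orbit_sumr d x G s (shadow d x k (2 * C0 + delta)))).
    apply: orbit_sumr_mono => // u Gu; rewrite /A /shadow /= => /negP.
    rewrite -ltNge => hu.
    have h1 : K - C0 <= gp x (h x) (u x) by move: near_const_ge1; lra.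
    have := hyp3 d delta hyp _ _ _ _ _ k2 h1.
    lra.
  apply: (le_trans (shadow_upper d delta D x G inM s s0 sfin k _ Gk)).
  apply: ler_wpM2r; first exact: orbit_sumr_ge0.
  (* Since [K - C0] is [n.+1] times [L], the decay is the power [n.+1] of a number at most [1 / 2];
     it beats the constant [2 ^+ n] and leaves a factor one half. *)
  apply: (@le_trans _ _ (expR (S * (4 * C0 + 2 * delta)) * expR (- (s * L)) ^+ n.+1)).
    rewrite -expRM_natl -expRD ler_expR.
    have h1 : s * (K - C0) <= s * len k by apply: ler_wpM2l.
    have h2 : s * (4 * C0 + 2 * delta) <= S * (4 * C0 + 2 * delta).
      by apply: ler_wpM2r => //; move: near_const_ge1 delta0; lra.
    move: h1 h2; rewrite /K addrC addKr; set m := n.+1%:R; lra.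
  apply: (@le_trans _ _ (2 ^+ n * (1 / 2) ^+ n.+1)).
    apply: ler_pM; rewrite ?exprn_ge0 ?expR_ge0 //.
    by rewrite lerXn2r ?nnegrE ?expR_ge0 // ?divr_ge0 // convergent_exponent.
  rewrite exprS mulrCA -exprMn.
  have -> : 2 * (1 / 2) = 1 :> R by lra.
  by rewrite expr1n mulr1.
have := orbit_sumr_split d x G s sfin setT A; rewrite !setTI => hsum.
have hA' : expR (- (s * len g)) * orbit_sumr d x G s A <= orbit_sumr d x G s (shadow d x g K).
  have := ler_wpM2l (expR_ge0 (- (s * len g))) hA.
  by rewrite mulrA -expRD addNr expR0 mul1r.
apply: le_trans hA'; rewrite -mulrA; apply: ler_wpM2l; first exact: expR_ge0.
by move: hB; rewrite hsum; lra.
Qed.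

(** Beyond distance [N] every [u] factors as [k \o v] with [k] in an annulus around [N] and [v] no
    longer than [u]. If the annulus has small mass at some [s < h], the far part of a ball carries
    at most half the mass of that ball, so all balls are bounded by twice the ball of radius [N],
    and the series converges at [s]. *)
Lemma divergent_at_exponent h : 0 < h ->
  (forall s, 0 <= s -> (psum s setT < +oo)%E -> h <= s) -> psum h setT = +oo%E.
Proof.
move=> h0 hmin; apply/eqP; rewrite -leye_eq leNgt; apply/negP => hfin.
have C01 := near_const_ge1.
(* Chosen so that [2 * eps] times the factorisation constant [expR (4 * C0 * h)] is exactly
   [1 / 2]. *)
pose eps : R := expR (- (4 * C0 * h)) / 4.
have eps0 : 0 < eps by rewrite divr_gt0 ?expR_gt0.
have [T hT] : exists T, (psum h [set u : X -> X | (T < len u)%R] <= eps%:E)%E.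
  have Mr := orbit_sum_fin d x G h hfin setT.
  have : ((orbit_sumr d x G h setT - eps)%:E < psum h setT)%E.
    by rewrite Mr lte_fin; move: eps0; lra.
  move=> /ereal_sup_gt[_ [F [fF FG] <-]] hlt.
  have [T hT] := finite_set_bounded F (fun u => len u) fF.
  exists T; have h1 := orbit_sumr_split d x G h hfin setT [set u : X -> X | (T < len u)%R].
  rewrite (orbit_sum_fin d x G h hfin) lee_fin.
  move: h1; rewrite !setTI => h1.
  have h2 : orbit_sumr d x G h setT - eps <= orbit_sumr d x G h (~` [set u : X -> X | (T < len u)%R]).
    rewrite -lee_fin -(orbit_sum_fin d x G h hfin); apply: le_trans (ltW hlt) _.
    apply: esum_ge; exists F => //; split=> // u Fu; split; first by have [] := FG u Fu.
    by apply/negP; rewrite -leNgt; apply: hT.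
  by move: h1 h2; lra.
(* [T + C0 + 1 <= N] puts the annulus beyond [T]; [3 * C0 <= N] ensures that the remaining factor
   [v] is no longer than [u]. *)
pose N := Num.max T (3 * C0) + C0 + 1.
have NT : T + C0 + 1 <= N by rewrite /N !lerD2r le_max lexx.
have N3 : 3 * C0 <= N by rewrite /N; apply: (@le_trans _ _ (Num.max T (3 * C0))); [rewrite le_max lexx orbT|lra].
(* Lowering the exponent by [eta] at most doubles the weights on the annulus; the minimum with [h]
   keeps [s] nonnegative. *)
pose eta := Num.min h (ln 2 / (N + C0)).
have ln20 : 0 < ln 2 :> R by rewrite ln_gt0 // ltr1n.
have eta0 : 0 < eta by rewrite lt_min h0 divr_gt0 //; lra.
pose s := h - eta.
have s0 : 0 <= s by rewrite subr_ge0 ge_min lexx.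
have sh : s < h by rewrite /s; lra.
have hsN : (h - s) * (N + C0) <= ln 2.
  have -> : h - s = eta by rewrite /s; lra.
  rewrite -ler_pdivlMr; last by lra.
  by rewrite ge_min lexx orbT.
suff sfin : (psum s setT < +oo)%E by have := hmin s s0 sfin; rewrite leNgt sh.
pose B (n : R) := [set u : X -> X | len u <= n].
(* Finiteness on balls, by comparison with the exponent [h], is what permits absorbing half of the
   ball into itself below. *)
have Bfin n : (psum s (B n) < +oo)%E.
  apply: (@le_lt_trans _ _ ((expR ((h - s) * n))%:E * psum h setT)%E).
    apply: (orbit_sum_translate d delta D x G inM _ _ id); first exact: (G_id d delta D x G inM).
    move=> u Gu; rewrite /B /= => hu; split=> //.
    have : (h - s) * len u <= (h - s) * n by apply: ler_wpM2l => //; lra.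
    by lra.
  by rewrite (orbit_sum_fin d x G h hfin) -EFinM ltry.
pose A := [set k : X -> X | N - C0 <= len k <= N + C0].
have hA : (psum s A <= (2 * eps)%:E)%E.
  apply: (@le_trans _ _ ((expR (ln 2))%:E * psum h [set u : X -> X | (T < len u)%R])%E).
    apply: (orbit_sum_translate d delta D x G inM _ _ id); first exact: (G_id d delta D x G inM).
    move=> u Gu; rewrite /A /= => /andP[u1 u2]; split; first by lra.
    have : (h - s) * len u <= (h - s) * (N + C0) by apply: ler_wpM2l => //; lra.
    by lra.
  rewrite lnK ?posrE // EFinM; apply: lee_wpmul2l => //; by rewrite lee_fin.
have step n : (psum s (B n `&` [set u : X -> X | (N < len u)%R]) <= (1 / 2)%:E * psum s (B n))%E.
  apply: (@le_trans _ _ ((expR (4 * C0 * h))%:E * (psum s (B n) * psum s A))%E); last first.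
    have Br : psum s (B n) = (fine (psum s (B n)))%:E.
      by rewrite fineK // ge0_fin_numE ?orbit_sum_ge0 //.
    have b0 : 0 <= fine (psum s (B n)) by rewrite fine_ge0 // orbit_sum_ge0.
    rewrite Br; apply: (@le_trans _ _ ((expR (4 * C0 * h))%:E * ((fine (psum s (B n)))%:E * (2 * eps)%:E))%E).
      apply: lee_wpmul2l; first by rewrite lee_fin expR_ge0.
      by apply: lee_wpmul2l => //; rewrite lee_fin.
    have e : expR (4 * C0 * h) * (2 * eps) = 1 / 2.
      rewrite /eps expRN; have := expR_gt0 (4 * C0 * h).
      by set E := expR _ => E0; field; exact: lt0r_neq0.
    by rewrite -!EFinM lee_fin mulrCA e mulrC.
  apply: (@esum_le_prod R {classic (X -> X)} {classic (X -> X)} {classic (X -> X)} id id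
    (G `&` (B n `&` [set u : X -> X | (N < len u)%R])) (G `&` A) (G `&` B n)
    (fun k v => k \o v) (expR (4 * C0 * h)) _ (fun k => expR (- (s * len k))) (fun v => expR (- (s * len v)))) => //.
  2: exact: Bfin.
  move=> u [Gu [Bu /= Nu]].
  have hN : 0 <= N <= len u by rewrite (ltW Nu) andbT; lra.
  have [k [Gk [/andP[k1 k3] k2]]] := orbit_at d delta D x G delta0 D0 inM u N Gu hN.
  have [l [Gl [kl lk]]] := G_inv d delta D x G inM _ Gk.
  have lenv : d x (l (u x)) = d (k x) (u x).
    by rewrite -{1}(kl x) (G_dist d delta D x G inM l).
  exists k, (l \o u); split.
  - by split=> //; rewrite /A /= k1 k3.
  - split; first exact: (G_comp d delta D x G inM).
    by move: Bu k2; rewrite /B /= lenv /gprod; lra.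
  - by apply: funext => y /=; rewrite lk.
  - rewrite lee_fin -!expRD ler_expR /= lenv.
    have e1 : len k + d (k x) (u x) - 4 * C0 <= len u by move: k2; rewrite /gprod; lra.
    have := ler_wpM2l s0 e1.
    have : s * (4 * C0) <= h * (4 * C0) by apply: ler_wpM2r; [lra|exact: ltW].
    lra.
have bound n : (psum s (B n) <= 2%:E * psum s (B N))%E.
  pose V := [set u : X -> X | (N < len u)%R].
  have sub : (psum s (B n `&` ~` V) <= psum s (B N))%E.
    by apply: orbit_sum_mono => u _ [_ /= /negP]; rewrite -leNgt.
  have := orbit_sum_split d x G s (B n) V; have := step n; rewrite -/V; move: sub.
  have e W : (psum s W <= psum s (B n))%E \/ (psum s W <= psum s (B N))%E ->
      exists r, psum s W = r%:E.
    move=> hW; exists (fine (psum s W)); rewrite fineK // ge0_fin_numE ?orbit_sum_ge0 //.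
    by case: hW => hW; [exact: le_lt_trans hW (Bfin n)|exact: le_lt_trans hW (Bfin N)].
  have [|r1 ->] := e (B n `&` V); first by left; apply: orbit_sum_mono => u _ [].
  have [|r2 ->] := e (B n `&` ~` V); first by left; apply: orbit_sum_mono => u _ [].
  have [|r3 ->] := e (B n); first by left.
  have [|r4 ->] := e (B N); first by right.
  by rewrite -!EFinM -!EFinD !lee_fin => h1 h2 [h3]; lra.
apply: (@le_lt_trans _ _ (2%:E * psum s (B N))%E); last first.
  rewrite -(@fineK _ (psum s (B N))) ?ge0_fin_numE ?orbit_sum_ge0 // -EFinM ltry //.
apply: ge_ereal_sup => _ [F [fF FG] <-].
have [M hM] := finite_set_bounded F (fun u => len u) fF.
apply: le_trans (bound M); apply: esum_ge; exists F => //; split=> // u Fu.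
by split; [have [] := FG u Fu|apply: hM].
Qed.

(** A finite partial sum at [h] already exceeds [2 * |B|], and a small increase of the exponent at
    most halves its finitely many terms. *)
Lemma orbit_sum_blowup h B : psum h setT = +oo%E ->
  exists2 eta, 0 < eta & forall s, h < s < h + eta -> (B%:E <= psum s setT)%E.
Proof.
move=> hinf.
have : ((2 * `|B|)%:E < psum h setT)%E by rewrite hinf ltry.
move=> /ereal_sup_gt[_ [F [fF FG] <-]] hlt.
have [T hT] := finite_set_bounded F (fun u => len u) fF.
have ln20 : 0 < ln 2 :> R by rewrite ln_gt0 // ltr1n.
have T0 : 0 < `|T| + 1 by rewrite ltr_wpDl.
exists (ln 2 / (`|T| + 1)); first by rewrite divr_gt0.
move=> s /andP[hs sh].
have h1 : ((2 * `|B|)%:E <= (expR (ln 2))%:E * psum s F)%E.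
  apply: (@le_trans _ _ (psum h F)).
    apply: le_trans (ltW hlt) _; apply: esum_ge; exists F => //; split=> // u Fu.
    by split=> //; have [] := FG u Fu.
  apply: (orbit_sum_translate d delta D x G inM _ _ id); first exact: (G_id d delta D x G inM).
  move=> u Gu Fu; split=> //=.
  have h2 : (s - h) * len u <= (s - h) * (`|T| + 1).
    apply: ler_wpM2l; first by lra.
    by apply: le_trans (hT _ Fu) _; apply: le_trans (ler_norm _) _; rewrite lerDl.
  have : (s - h) * (`|T| + 1) <= ln 2 by rewrite -ler_pdivlMr //; lra.
  lra.
have {}h1 : ((2 * `|B|)%:E <= 2%:E * psum s setT)%E.
  move: h1; rewrite lnK ?posrE // => /le_trans; apply.
  by apply: lee_wpmul2l; rewrite ?lee_fin //; apply: orbit_sum_mono.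
have [fi|] := ltP (psum s setT) +oo%E; last by rewrite leye_eq => /eqP ->; rewrite leey.
move: h1; rewrite (orbit_sum_fin d x G s fi) -EFinM !lee_fin ler_pM2l //.
exact: le_trans (ler_norm _).
Qed.
End CriticalExponent.

(** * Borel measurability of visual balls *)

Section ExtendedProduct.
Context {R : realType} {X : Type} (d : X -> X -> R) (delta : R) (x : X).
Hypothesis met : is_metric d.
Hypothesis hyp : is_hyperbolic d delta.
Hypothesis geo : is_geodesic d.
Hypothesis prop : is_proper d.
Hypothesis delta0 : 0 <= delta.
Local Notation gp := (gprod d).
Local Notation equiv := (seq_equiv d x).
Implicit Types (p q z : Bord d x) (u v w a b : nat -> X).

Lemma egp_gt p q (r : R) : (r%:E < egp p q)%E -> exists a b N, [/\ seqs p a, seqs q b &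
  forall n m, (N <= n)%N -> (N <= m)%N -> r < gp x (a n) (b m)].
Proof.
move=> /ereal_sup_gt[_ [a [b [pa [qb ->]]]]] /ereal_sup_gt[_ [N _ <-] hN].
exists a, b, N; split=> // n m nN mN; rewrite -lte_fin; apply: lt_le_trans hN _.
by apply: ereal_inf_lbound; exists n, m.
Qed.

Lemma egp_ge p q (r : R) a b N : seqs p a -> seqs q b ->
  (forall n m, (N <= n)%N -> (N <= m)%N -> r <= gp x (a n) (b m)) -> (r%:E <= egp p q)%E.
Proof.
move=> pa qb h; apply: (@le_trans _ _ (dliminf (fun n m => gp x (a n) (b m)))).
  apply: le_ereal_sup_tmp; exists (ereal_inf [set y | exists n m, (N <= n)%N /\ (N <= m)%N /\
      y = (gp x (a n) (b m))%:E]); first by exists N.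
  by apply: le_ereal_inf_tmp => _ [n [m [nN [mN ->]]]]; rewrite lee_fin; apply: h.
by apply: ereal_sup_ubound; exists a, b.
Qed.

Lemma seq_equiv_pointwise (c : R) a w : conv_inf d x w ->
  (forall k, exists N, forall m, (N <= m)%N -> k%:R - c <= gp x (a k) (w m)) -> equiv a w.
Proof.
move=> cw h r; have [N1 h1] := cw (r + delta).
have [N2 h2] := nat_unbounded (r + delta + 1 + c).
exists (maxn N1 N2) => n m; rewrite !geq_max => /andP[n1 n2] /andP[m1 m2].
have [N3 h3] := h n; have k2 := h2 n n2.
have k3 := h3 (maxn N1 N3) (leq_maxr _ _).
have k1 := h1 (maxn N1 N3) m (leq_maxl _ _) m1.
pose t := Num.min (gp x (w (maxn N1 N3)) (w m)) (r + delta + 1).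
have ht : r + delta < t by rewrite lt_min k1 ltrDl ltr01.
have t1 : t <= gp x (w (maxn N1 N3)) (w m) by rewrite ge_min lexx.
have t2 : t <= gp x (a n) (w (maxn N1 N3)).
  by apply: le_trans k3; rewrite ge_min; apply/orP; right; lra.
by have := hyp3 d delta hyp _ _ _ _ _ t2 t1; lra.
Qed.

Lemma seq_equiv_sub a w (n : nat -> nat) : (forall k, (k <= n k)%N) -> equiv a w ->
  equiv (a \o n) w.
Proof.
move=> hn h r; have [N hN] := h r; exists N => i j Ni Nj /=; apply: hN => //.
exact: leq_trans Ni (hn i).
Qed.

Lemma near_geodesic_pt (y a b : X) : exists c, d a c + d c b = d a b /\
  d y c <= gp y a b + 2 * delta.
Proof.
have [g hg] := geo a b.
have [/andP[t0 t1] hd] := near_geod d delta met hyp _ _ _ y hg.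
exists (g (gp a y b)); split=> //; move: t0 t1 {hd}; set t := gp a y b => t0 t1.
case: hg => g0 [g1 gi]; have v0 : 0 <= (0 : R) <= d a b by rewrite lexx d_ge0.
have v1 : 0 <= d a b <= d a b by rewrite lexx d_ge0.
have vt : 0 <= t <= d a b by rewrite t0 t1.
have e1 : d a (g t) = t by rewrite -{1}g0 gi // sub0r normrN ger0_norm.
have e2 : d (g t) b = d a b - t by rewrite -{1}g1 gi // distrC ger0_norm ?subr_ge0.
by rewrite e1 e2; lra.
Qed.

Lemma bconv_bd (q : nat -> Bord d x) p : is_bd p -> bconv q p ->
  forall r : R, exists N : nat, forall n, (N <= n)%N -> (r%:E < egp (q n) p)%E.
Proof. by rewrite /bconv /is_bd; case: (sval p). Qed.

(** The [q N] close to [p] serves as an intermediary: a term of a sequence representing it is also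
    close to [p]. The loss [k.+1%:R^-1] is due to the supremum in [egp]. *)
Lemma approximating_pair z p (s : R) (q : nat -> Bord d x) w v :
  is_bd z -> is_bd p -> (forall k, is_bd (q k)) -> seqs z w -> seqs p v ->
  (forall k, s%:E <= egp z (q k))%E -> bconv q p ->
  forall k, exists ab : X * X, [/\ s - k.+1%:R^-1 <= gp x ab.1 ab.2,
    (exists N, forall m, (N <= m)%N -> k%:R <= gp x ab.1 (w m)) &
    (exists N, forall m, (N <= m)%N -> k%:R - 2 * delta <= gp x ab.2 (v m))].
Proof.
move=> bz bp bq zw pv hs cq k.
have [N hN] : exists N : nat, forall n, (N <= n)%N -> (k%:R%:E < egp (q n) p)%E.
  exact: bconv_bd bp cq _.
have h1 : ((s - k.+1%:R^-1)%:E < egp z (q N))%E.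
  by apply: lt_le_trans (hs N); rewrite lte_fin ltrBlDr ltrDl invr_gt0.
have [a [b [N1 [za qb hab]]]] := egp_gt _ _ _ h1.
have [c [e [N2 [qc pe hce]]]] := egp_gt _ _ _ (hN N (leqnn N)).
have [N3 h3] := seqs_equiv d delta x met hyp _ _ _ bz za zw k%:R.
have [N4 h4] := seqs_equiv d delta x met hyp _ _ _ (bq N) qb qc k%:R.
have [N5 h5] := seqs_equiv d delta x met hyp _ _ _ bp pe pv k%:R.
pose M := (N1 + (N2 + (N3 + (N4 + N5))))%N.
have [M1 [M2 [M3 [M4 M5]]]] : (N1 <= M /\ N2 <= M /\ N3 <= M /\ N4 <= M /\ N5 <= M)%N.
  by rewrite /M; lia.
exists (a M, b M); split=> /=.
- exact/ltW/hab.
- by exists M => m hm; apply/ltW/h3 => //; apply: leq_trans hm.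
- exists M => m hm.
  have k1 := ltW (h4 M M M4 M4); have k2 := ltW (hce M M M2 M2).
  have k3 := ltW (h5 M m M5 (leq_trans M5 hm)).
  exact: (hyp4 d delta hyp delta0 _ _ _ _ _ _ k1 k2 k3).
Qed.

(* Properness forces semicontinuity: geodesics from [a k] to [b k] cross a fixed ball, and
   rerouting [a i] to [b j] through a limit of crossing points costs arbitrarily little. *)
Lemma egp_usc z p (s : R) (q : nat -> Bord d x) :
  is_bd z -> is_bd p -> (forall k, is_bd (q k)) -> (forall k, s%:E <= egp z (q k))%E ->
  bconv q p -> (s%:E <= egp z p)%E.
Proof.
move=> bz bp bq hs cq.
have [w zw] := seqs_ex d x z; have [v pv] := seqs_ex d x p.
have [ab hab] := choice (approximating_pair z p s q w v bz bp bq zw pv hs cq).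
pose a k := (ab k).1; pose b k := (ab k).2.
have aw : equiv a w.
  apply: (seq_equiv_pointwise 0); first exact: seqs_conv bz zw.
  by move=> k; have [_ [N hN] _] := hab k; exists N => m /hN; rewrite subr0.
have bv : equiv b v.
  apply: (seq_equiv_pointwise (2 * delta)); first exact: seqs_conv bp pv.
  by move=> k; have [_ _ [N hN]] := hab k; exists N => m /hN.
have seqz u : equiv u w -> seqs z u.
  by move=> h; apply: (seqs_closed d delta x met hyp _ _ _ bz zw); apply: seq_equiv_sym.
have seqp u : equiv u v -> seqs p u.
  by move=> h; apply: (seqs_closed d delta x met hyp _ _ _ bp pv); apply: seq_equiv_sym.
(* If the products reach [s + 2 * delta] infinitely often, [hyp4] alone gives the bound. Otherwise
   the geodesics stay within a fixed distance of [x], and properness applies. *)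
have [inf|/existsNP[N0 /forallNP fin]] :=
    pselect (forall N, exists k, (N <= k)%N /\ s + 2 * delta <= gp x (a k) (b k)).
  have [N1 h1] := seqs_conv d x _ _ bz (seqz _ aw) (s + 2 * delta).
  have [N2 h2] := seqs_conv d x _ _ bp (seqp _ bv) (s + 2 * delta).
  apply: (egp_ge _ _ _ _ _ (maxn N1 N2) (seqz _ aw) (seqp _ bv)) => n m.
  rewrite !geq_max => /andP[n1 n2] /andP[m1 m2].
  have [k []] := inf (maxn N1 N2); rewrite geq_max => /andP[k1 k2] hk.
  have := hyp4 d delta hyp delta0 _ _ _ _ _ _ (ltW (h1 n k n1 k1)) hk (ltW (h2 k m k2 m2)).
  by lra.
pose C := s + 2 * delta.
have hC k : gp x (a (N0 + k)%N) (b (N0 + k)%N) <= C.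
  by rewrite leNgt; apply/negP => h; apply: (fin (N0 + k)%N); split; [exact: leq_addr|exact: ltW].
have [c hc] := choice (fun k => near_geodesic_pt x (a (N0 + k)%N) (b (N0 + k)%N)).
have [U [UU UN]] := nonprincipal_ultrafilter.
have cb k : d x (c k) <= C + 2 * delta by apply: le_trans (hc k).2 _; rewrite lerD2r.
have [c' hc'] : exists y, forall e, 0 < e -> U [set n | d (c n) y < e].
  apply: (ultralimit_mcompact d met U UU _ _ (prop x (C + 2 * delta))).
  by apply: (ultraS UU _ (UN 0%N)) => n _ /=; exact: cb.
(* A Busemann-type difference: once it is nearly constant along the ultrafilter, exchanging
   [a (N0 + j)] for [a (N0 + i)] barely changes the product with [b (N0 + j)]. *)
pose al k := d x (a (N0 + k)%N) - d (a (N0 + k)%N) (c k).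
have [l hl] : exists l, forall e, 0 < e -> U [set n | `|al n - l| < e].
  apply: (ultralimit_real U UU UN _ (C + 2 * delta)) => k.
  apply: le_trans (cb k); rewrite ler_norml /al.
  have := dtri d met x (c k) (a (N0 + k)%N); have := dtri d met (a (N0 + k)%N) x (c k).
  rewrite (dC d met (c k)) (dC d met (a (N0 + k)%N) x) => *.
  by apply/andP; split; lra.
have key (e : R) : 0 < e -> ((s - 3 * e)%:E <= egp z p)%E.
  move=> e0; have hU := ultraI UU (hc' e e0) (hl e e0).
  have [n hn] := choice (fun N => ultra_ex_ge U UU UN _ N hU).
  have [M hM] := nat_unbounded e^-1.
  have nk k : (k <= (fun i => N0 + n i) k)%N by have [h _] := hn k; apply: leq_trans h (leq_addl _ _).
  apply: (egp_ge _ _ _ _ _ M (seqz _ (seq_equiv_sub _ _ _ nk aw)) (seqp _ (seq_equiv_sub _ _ _ nk bv))).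
  move=> i j Mi Mj /=.
  have [_ [/= ci]] := hn i; rewrite ltr_norml => /andP[ai1 ai2].
  have [_ [/= cj]] := hn j; rewrite ltr_norml => /andP[aj1 aj2].
  have hs' : s - e <= gp x (a (N0 + n j)%N) (b (N0 + n j)%N).
    have [h _ _] := hab (N0 + n j)%N; apply: le_trans h.
    rewrite lerD2l lerN2 -[leRHS]invrK lef_pV2 ?posrE ?invr_gt0 ?ltr0n //.
    apply: hM; apply: leq_trans Mj _; apply: leq_trans (leqnSn _).
    exact: nk.
  have := dtri d met (a (N0 + n i)%N) (c (n i)) (b (N0 + n j)%N).
  have := dtri d met (c (n i)) c' (b (N0 + n j)%N).
  have := dtri d met c' (c (n j)) (b (N0 + n j)%N).
  have := (hc (n j)).1.
  move: hs' ai1 ai2 aj1 aj2 ci cj; rewrite /al /gprod (dC d met c' (c (n j))); lra.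
case: (egp z p) key => [r| |] key; [|by rewrite leey|by have := key 1 ltr01].
rewrite lee_fin leNgt; apply/negP => rs.
have e0 : 0 < (s - r) / 4 by rewrite divr_gt0 // subr_gt0.
by have := key _ e0; rewrite lee_fin; lra.
Qed.

Lemma bopen_measurable (U : set (Bord d x)) : bopen U ->
  measurable (U : set (BordM d x)).
Proof. by move=> oU; apply: sub_sigma_algebra. Qed.

Lemma bconv_sub (q : nat -> Bord d x) p (n : nat -> nat) : (forall k, (k <= n k)%N) ->
  bconv q p -> bconv (q \o n) p.
Proof.
move=> hn; rewrite /bconv; case: (sval p) => [y|C] h.
  move=> e e0; have [N hN] := h e e0; exists N => k kN; apply: hN.
  exact: leq_trans kN (hn k).
move=> r; have [N hN] := h r; exists N => k kN; apply: hN.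
exact: leq_trans kN (hn k).
Qed.

Lemma bopen_interior : bopen [set p : Bord d x | ~ is_bd p].
Proof.
move=> p q /=; rewrite /is_bd /bconv; case: (sval p) => [y _ h|C /(_ I)//].
have [N hN] := h 1 ltr01; exists N => n /hN[z' [-> _]]; exact.
Qed.

(** By upper semicontinuity the complement is open: a sequence returning to the set infinitely often
    would place its limit in the set. *)
Lemma measurable_egp_ge z (s : R) : is_bd z ->
  measurable ([set p | is_bd p /\ (s%:E <= egp z p)%E] : set (BordM d x)).
Proof.
move=> bz; rewrite -[X in measurable X]setCK; apply: measurableC; apply: bopen_measurable.
move=> p q np cq; apply: contrapT => /forallNP h.
have h' N : exists n, (N <= n)%N /\ (is_bd (q n) /\ (s%:E <= egp z (q n))%E).
  have /existsNP[n /not_implyP[nN nn]] := h N; exists n; split=> //.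
  exact: contrapT.
have [n hn] := choice h'.
have cqn := bconv_sub _ _ _ (fun k => (hn k).1) cq.
have [bp|nbp] := pselect (is_bd p).
  apply: np; split=> //.
  apply: (egp_usc z p s _ bz bp _ _ cqn) => k; by have [_ []] := hn k.
have [N hN] := bopen_interior p _ nbp cqn.
by apply: (hN N (leqnn N)); have [_ []] := hn N.
Qed.

(** Semicontinuity handles only the non-strict inequality, so the ball is exhausted by superlevel
    sets with thresholds decreasing to [ln (1 / rho)]. *)
Lemma measurable_vball z rho : is_bd z -> measurable (vball z rho : set (BordM d x)).
Proof.
move=> bz.
have -> : vball z rho = \bigcup_k [set p | is_bd p /\
    ((ln (1 / rho) + k.+1%:R^-1)%:E <= egp z p)%E].
  apply/seteqP; split=> p /=.
    move=> [bp]; case e : (egp z p) => [r| |] //; last first.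
      by move=> _; exists 0%N => //; split=> //; rewrite e leey.
    rewrite lte_fin => hr; have e0 : 0 < (r - ln (1 / rho)) by rewrite subr_gt0.
    have [M hM] := nat_unbounded (r - ln (1 / rho))^-1.
    exists M => //; split=> //; rewrite e lee_fin.
    rewrite addrC -lerBrDr -[leRHS]invrK lef_pV2 ?posrE ?invr_gt0 ?ltr0n //.
    exact: hM.
  move=> [k _ [bp hk]]; split=> //; apply: lt_le_trans hk.
  by rewrite lte_fin ltrDl invr_gt0.
apply: bigcup_measurable => k _; exact: measurable_egp_ge.
Qed.
End ExtendedProduct.

(** * Continuous test functions *)

Section Chains.
Context {R : realType} {X : Type} (d : X -> X -> R) (delta : R) (x : X).
Hypothesis met : is_metric d.
Hypothesis hyp : is_hyperbolic d delta.
Hypothesis delta0 : 0 <= delta.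
Local Notation gp := (gprod d).

(* Small enough that [visual] below is a quasi-ultrametric with constant [sqrt 2]. *)
Definition visual_exp : R := ln 2 / (2 * (delta + 1)).
Local Notation eps := visual_exp.
Definition visual (a b : X) : R := expR (- (eps * gp x a b)).
Let kappa := expR (eps * delta).

Lemma visual_exp_gt0 : 0 < eps.
Proof. by rewrite divr_gt0 ?ln_gt0 ?ltr1n //; move: delta0; lra. Qed.

Lemma kappa_ge1 : 1 <= kappa.
Proof. by rewrite -expR0 ler_expR mulr_ge0 // ltW // visual_exp_gt0. Qed.

Lemma kappa_sqr : kappa * kappa <= 2.
Proof.
rewrite -expRD -[leRHS]lnK ?posrE // ler_expR /visual_exp.
have d1 : 0 < delta + 1 by move: delta0; lra.
have -> : ln 2 / (2 * (delta + 1)) * delta + ln 2 / (2 * (delta + 1)) * delta =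
    ln 2 * (delta / (delta + 1)) :> R by field; exact: lt0r_neq0.
rewrite -[leRHS]mulr1; apply: ler_wpM2l; first by rewrite ln_ge0 // ler1n.
by rewrite ler_pdivrMr // mul1r; lra.
Qed.

Lemma visual_gt0 a b : 0 < visual a b.
Proof. exact: expR_gt0. Qed.

Lemma visual_ultra a b c M : visual a b <= M -> visual b c <= M -> visual a c <= kappa * M.
Proof.
move=> h1 h2; have e0 := visual_exp_gt0.
have [t [t1 t2 t3]] : exists t, [/\ t <= gp x a b, t <= gp x b c &
    expR (- (eps * t)) <= M].
  by have [o|/ltW o] := lerP (gp x a b) (gp x b c);
    [exists (gp x a b)|exists (gp x b c)].
have := hyp3 d delta hyp _ _ _ _ _ t1 t2.
move=> /(ler_wpM2l (ltW e0)) h.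
apply: le_trans (_ : kappa * expR (- (eps * t)) <= _); last first.
  by apply: ler_wpM2l => //; exact: expR_ge0.
by rewrite -expRD ler_expR; move: h; rewrite mulrBr; lra.
Qed.

Fixpoint chain (a : X) (l : seq X) : R :=
  if l is b :: l' then visual a b + chain b l' else 0.

Lemma chain_ge0 a l : 0 <= chain a l.
Proof. by elim: l a => //= b l IH a; rewrite addr_ge0 // ltW // visual_gt0. Qed.

Lemma chain_cat a l1 l2 : chain a (l1 ++ l2) = chain a l1 + chain (last a l1) l2.
Proof. by elim: l1 a => [|b l1 IH] a /=; rewrite ?add0r // IH addrA. Qed.

Lemma chain_split a l (t : R) : 0 <= t -> l <> [::] -> exists l1 b l2,
  [/\ l = l1 ++ b :: l2, chain a l1 <= t & t <= chain a (rcons l1 b) \/ l2 = [::]].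
Proof.
elim: l a t => // b l IH a t t0 _.
have [h|h] := lerP t (visual a b).
  by exists [::], b, l; split=> //=; left; rewrite addr0.
case: l IH => [|b' l'] IH; first by exists [::], b, [::]; split=> //; right.
have [||l1 [c [l2 [-> h1 h2]]]] := IH b (t - visual a b); [by rewrite subr_ge0 ltW|by []|].
exists (b :: l1), c, l2; split=> //=; first by lra.
by case: h2 => h2; [left; lra|right].
Qed.

(** Frink's metrization argument. Cut the chain at half of its length: by induction each part joins
    points at visual size at most the total [S], the middle link is also at most [S], and two
    quasi-ultrametric steps cost [kappa * kappa <= 2]. *)
Lemma visual_le_chain a l : l <> [::] -> visual a (last a l) <= 2 * chain a l.
Proof.
have [n] := ubnP (size l); elim: n l a => // n IH l a sz ne.
have k1 := kappa_ge1; have k2 := kappa_sqr.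
have S0 : 0 <= chain a l / 2 by rewrite divr_ge0 // chain_ge0.
have [l1 [b [l2 [el h1 h2]]]] := chain_split a l (chain a l / 2) S0 ne.
pose S := chain a l.
have eS : S = chain a l1 + (visual (last a l1) b + chain b l2).
  by rewrite /S el chain_cat.
have c1 := chain_ge0 a l1; have c2 := chain_ge0 b l2; have c3 := visual_gt0 (last a l1) b.
have SS : 0 <= S by rewrite eS; lra.
have kS : S <= kappa * S by rewrite ler_peMl.
have hb : visual (last a l1) b <= S by rewrite eS; lra.
have h3 : l2 = [::] \/ chain b l2 <= S / 2.
  case: h2 => h2; [right|by left].
  by move: h2; rewrite -cats1 chain_cat /= -/S; lra.
have s1 : (size l1 < n)%N by move: sz; rewrite el size_cat /=; clear; lia.
have s2 : (size l2 < n)%N by move: sz; rewrite el size_cat /=; clear; lia.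
have hab : visual a b <= kappa * S.
  have [l10|l1n] := pselect (l1 = [::]); first by move: hb; rewrite l10 /=; lra.
  have hl : visual a (last a l1) <= S by have := IH l1 a s1 l1n; rewrite -/S in h1; lra.
  exact: visual_ultra hl hb.
have el' : last a l = last b l2 by rewrite el last_cat.
have k2S : kappa * (kappa * S) <= 2 * S by rewrite mulrA; apply: ler_wpM2r.
rewrite el' -/S; case: h3 => h3.
  rewrite h3 /=; apply: (le_trans hab); apply: le_trans k2S.
  by rewrite ler_peMl // mulr_ge0 // expR_ge0.
have [l20|l2n] := pselect (l2 = [::]).
  rewrite l20 /=; apply: (le_trans hab); apply: le_trans k2S.
  by rewrite ler_peMl // mulr_ge0 // expR_ge0.
have hl : visual b (last b l2) <= kappa * S by have := IH l2 b s2 l2n; lra.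
exact: le_trans (visual_ultra _ _ _ _ hab hl) k2S.
Qed.

Context (y0 : X) (T1 T2 : R).
Hypothesis T12 : T1 + delta + 2 <= T2.

(** Costs of reaching [y] from the set where the product with [y0] is at least [T2]. As [visual]
    does not vanish on the diagonal, a last step measured by [d] is added, which yields continuity
    at points of [X]; the cost 1 is a cap keeping that step short in the cases that matter. *)
Definition chain_costs (y : X) : set R := [set r | r = 1 \/
  exists s l, T2 <= gp x y0 s /\ r = chain s l + d (last s l) y].
Definition chain_dist (y : X) : R := inf (chain_costs y).

Lemma chain_costs_lb y : lbound (chain_costs y) 0.
Proof.
by move=> r [->|[s [l [_ ->]]]] //; rewrite addr_ge0 ?chain_ge0 // d_ge0.
Qed.

Lemma chain_dist_le y r : chain_costs y r -> chain_dist y <= r.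
Proof. by move=> h; apply: ge_inf => //; exists 0; exact: chain_costs_lb. Qed.

Lemma le_chain_dist y m : lbound (chain_costs y) m -> m <= chain_dist y.
Proof. by move=> h; apply: lb_le_inf => //; exists 1; left. Qed.

Lemma chain_dist_ge0 y : 0 <= chain_dist y.
Proof. exact: le_chain_dist (chain_costs_lb y). Qed.

Lemma chain_dist_le1 y : chain_dist y <= 1.
Proof. by apply: chain_dist_le; left. Qed.

Lemma chain_dist0 y : T2 <= gp x y0 y -> chain_dist y = 0.
Proof.
move=> h; apply/le_anti/andP; split; last exact: chain_dist_ge0.
by apply: chain_dist_le; right; exists y, [::]; split=> //=; rewrite (dxx d met) addr0.
Qed.

Lemma chain_dist_lip y y' : chain_dist y <= chain_dist y' + d y y'.
Proof.
rewrite -lerBlDr; apply: le_chain_dist => r [->|[s [l [hs ->]]]]; rewrite lerBlDr.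
  by apply: le_trans (chain_dist_le1 y) _; rewrite lerDl d_ge0.
apply: (@le_trans _ _ (chain s l + d (last s l) y)).
  by apply: chain_dist_le; right; exists s, l.
by have := dtri d met (last s l) y' y; rewrite (dC d met y' y); lra.
Qed.

(** For a cost below 1 the last step has length at most 1, so trading it for a visual link to [y]
    changes a product by at most 1, whence the factor [expR eps]. *)
Lemma chain_dist_visual y y' : chain_dist y <= chain_dist y' + expR eps * visual y y'.
Proof.
have v0 : 0 <= expR eps * visual y y' by rewrite mulr_ge0 // expR_ge0.
rewrite -lerBlDr; apply: le_chain_dist => r hr; rewrite lerBlDr.
have [r1|r1] := lerP 1 r.
  by apply: le_trans (chain_dist_le1 y) _; rewrite -[leLHS]addr0 lerD.
case: hr => [hr|[s [l [hs hr]]]]; first by move: r1; rewrite hr ltxx.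
have dl : d (last s l) y' <= 1 by have := chain_ge0 s l; move: r1; rewrite hr; lra.
have h : chain_dist y <= chain s l + visual (last s l) y.
  apply: chain_dist_le; right; exists s, (rcons l y); split=> //.
  by rewrite -cats1 chain_cat last_cat /= (dxx d met) !addr0.
apply: (le_trans h); rewrite hr.
have : visual (last s l) y <= expR eps * visual y y'.
  rewrite -expRD ler_expR.
  have h1 : gp x y y' <= gp x (last s l) y + 1.
    rewrite (gpC d met x y); have := gp_lipl d met x y' (last s l) y.
    by rewrite (dC d met y'); lra.
  by have := ler_wpM2l (ltW visual_exp_gt0) h1; rewrite mulrDr; lra.
by have := d_ge0 d met (last s l) y'; lra.
Qed.

Let gap := Num.min 1 (expR (- (eps * (T1 + 1 + delta))) / 2).

(** A cheap chain ends within 1 of [y], so its last vertex still has product at most [T1 + 1] with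
    [y0]. Since the chain starts where the product is at least [T2], hyperbolicity separates its
    ends visually, and [visual_le_chain] bounds its cost below. *)
Lemma chain_dist_far y : gp x y0 y <= T1 -> gap <= chain_dist y.
Proof.
move=> hy; apply: le_chain_dist => r hr.
have [r1|r1] := lerP 1 r; first by rewrite ge_min r1.
case: hr => [hr|[s [l [hs hr]]]]; first by move: r1; rewrite hr ltxx.
have dl : d (last s l) y <= 1 by have := chain_ge0 s l; move: r1; rewrite hr; lra.
have hw : gp x y0 (last s l) <= T1 + 1.
  by have := gp_lipr d met x y0 (last s l) y; lra.
have ne : l <> [::] by move=> l0; move: hw hs T12 delta0; rewrite l0 /=; lra.
have hsw : gp x s (last s l) <= T1 + 1 + delta.
  rewrite leNgt; apply/negP => hlt.
  have [t [ht [t1 t2]]] : exists t, T1 + 1 + delta < t /\ t <= T2 /\ t <= gp x s (last s l).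
    exists (Num.min T2 (gp x s (last s l))).
    by rewrite lt_min hlt andbT !ge_min !lexx orbT; split=> //; move: T12; lra.
  have := hyp3 d delta hyp _ _ _ _ _ (le_trans t1 hs) t2; lra.
have hv : expR (- (eps * (T1 + 1 + delta))) <= visual s (last s l).
  by rewrite ler_expR lerN2; apply: ler_wpM2l => //; exact: ltW visual_exp_gt0.
have := visual_le_chain s l ne; have := d_ge0 d met (last s l) y.
by rewrite ge_min hr => h1 h2; apply/orP; right; lra.
Qed.

Lemma separating_function : exists (F : X -> R) (C : R), [/\ 0 <= C,
  (forall y, 0 <= F y <= 1), (forall y, T2 <= gp x y0 y -> F y = 1),
  (forall y, gp x y0 y <= T1 -> F y = 0) &
  (forall y y', `|F y - F y'| <= C * d y y' /\ `|F y - F y'| <= C * visual y y')].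
Proof.
have g0 : 0 < gap by rewrite lt_min ltr01 divr_gt0 // expR_gt0.
pose F y := Num.max 0 (1 - chain_dist y / gap).
have e1 : 1 <= expR eps by rewrite -expR0 ler_expR ltW // visual_exp_gt0.
have half y y' (r : R) : 0 <= r -> chain_dist y' <= chain_dist y + r ->
    F y <= F y' + r / gap.
  move=> r0 h; rewrite /F ge_max; apply/andP; split.
    by rewrite addr_ge0 // ?le_max ?lexx // divr_ge0 // ltW.
  apply: (@le_trans _ _ (1 - chain_dist y' / gap + r / gap)).
    rewrite -addrA lerD2l; have : chain_dist y' / gap <= (chain_dist y + r) / gap.
      by rewrite ler_pM2r ?invr_gt0.
    by rewrite mulrDl; lra.
  by rewrite lerD2r le_max lexx orbT.
exists F, (expR eps / gap); split.
- by rewrite divr_ge0 ?expR_ge0 // ltW.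
- move=> y; rewrite /F le_max lexx ge_max ler01 /=.
  by rewrite gerDl oppr_le0 divr_ge0 ?chain_dist_ge0 // ltW.
- by move=> y /chain_dist0 h; rewrite /F h mul0r subr0; apply/max_idPr.
- move=> y /chain_dist_far h; rewrite /F; apply/max_idPl.
  by rewrite subr_le0 ler_pdivlMr // mul1r.
have abs (r : R) y y' : 0 <= r -> chain_dist y' <= chain_dist y + r ->
    chain_dist y <= chain_dist y' + r -> `|F y - F y'| <= r / gap.
  move=> r0 h1 h2; rewrite ler_norml.
  have := half _ _ _ r0 h1; have := half _ _ _ r0 h2.
  by move=> *; apply/andP; split; lra.
move=> y y'; split.
  apply: (@le_trans _ _ (d y y' / gap)).
    apply: abs; [exact: d_ge0|rewrite (dC d met y y')|]; exact: chain_dist_lip.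
  rewrite [leRHS]mulrAC; apply: ler_wpM2r; first by rewrite invr_ge0 ltW.
  by rewrite ler_peMl // d_ge0.
rewrite [leRHS]mulrAC; apply: abs.
- by rewrite mulr_ge0 ?expR_ge0.
- by rewrite /visual (gpC d met); exact: chain_dist_visual.
- exact: chain_dist_visual.
Qed.
End Chains.

(** * Extension of functions from the space to its boundary *)

Section Extension.
Context {R : realType} {X : Type} (d : X -> X -> R) (delta : R) (x : X).
Hypothesis met : is_metric d.
Hypothesis hyp : is_hyperbolic d delta.
Hypothesis delta0 : 0 <= delta.
Local Notation gp := (gprod d).
Local Notation eps := (visual_exp delta).
Local Notation vis := (visual d delta x).

Lemma visual_small (C e : R) : 0 <= C -> 0 < e -> exists r,
  forall a b, r < gp x a b -> C * vis a b < e.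
Proof.
move=> C0 e0; have p0 := visual_exp_gt0 delta delta0.
exists (C / e / eps) => a b; rewrite ltr_pdivrMr // => h.
rewrite /visual expRN ltr_pdivrMr ?expR_gt0 //.
apply: (@lt_le_trans _ _ (e * (1 + eps * gp x a b))).
  move: h; rewrite ltr_pdivrMr // mulrDr mulr1 (mulrC eps) (mulrC e (_ * _)) => h.
  by rewrite ltr_wpDl // ltW.
by rewrite ler_pM2l // expR_ge1Dx.
Qed.

Context (F : X -> R) (C M : R).
Hypothesis C0 : 0 <= C.
Hypothesis FM : forall y, `|F y| <= M.
Hypothesis FL : forall y y', `|F y - F y'| <= C * d y y' /\ `|F y - F y'| <= C * vis y y'.

Lemma limits_agree (a b : nat -> X) : seq_equiv d x a b -> forall e, 0 < e ->
  exists N, forall n m, (N <= n)%N -> (N <= m)%N -> `|F (a n) - F (b m)| < e.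
Proof.
move=> ab e e0; have [r hr] := visual_small C e C0 e0.
have [N hN] := ab r; exists N => n m nN mN.
exact: le_lt_trans (FL _ _).2 (hr _ _ (hN n m nN mN)).
Qed.

(** The visual bound makes [F] Cauchy along sequences converging to the boundary and gives
    continuity there; the bound by [d] gives continuity at points of [X]. *)
Lemma boundary_extension : exists Fb : Bord d x -> R, bcont Fb /\
  forall p a, seqs p a -> forall e, 0 < e ->
    exists N, forall n, (N <= n)%N -> `|F (a n) - Fb p| < e.
Proof.
have ex (p : Bord d x) : exists l, forall a, seqs p a -> forall e, 0 < e ->
    exists N, forall n, (N <= n)%N -> `|F (a n) - l| < e.
  have [bp|nbp] := pselect (is_bd p).
    have [a pa] := seqs_ex d x p.
    have [U [UU UN]] := nonprincipal_ultrafilter.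
    have [l hl] := ultralimit_real U UU UN (F \o a) M (fun n => FM (a n)).
    exists l => b pb e e0; have e2 : 0 < e / 2 by rewrite divr_gt0.
    have [N hN] := limits_agree _ _ (seqs_equiv d delta x met hyp _ _ _ bp pa pb) _ e2.
    have [k [kN /= hk]] := ultra_ex_ge U UU UN _ N (hl _ e2).
    exists N => n nN; have := hN k n kN nN; move: hk.
    rewrite !ltr_norml => /andP[? ?] /andP[? ?]; apply/andP; split; lra.
  case: p nbp => -[y|B] hB nb; last by case: nb.
  exists (F y) => a -> e e0.
  by exists 0%N => n _; rewrite subrr normr0.
have [Fb hF] := choice ex; exists Fb; split=> // p q cq e e0.
have e4 : 0 < e / 4 by rewrite divr_gt0.
have [bp|nbp] := pselect (is_bd p).
  have [r hr] := visual_small C (e / 4) C0 e4.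
  have [N hN] := bconv_bd d x q p bp cq r.
  exists N => n nN; have [a [b [N1 [qa pb hab]]]] := egp_gt d x _ _ _ (hN n nN).
  have [N2 h2] := hF (q n) a qa _ e4; have [N3 h3] := hF p b pb _ e4.
  pose k := (N1 + (N2 + N3))%N.
  have k2 := h2 k; have k3 := h3 k.
  have k1 := le_lt_trans (FL (a k) (b k)).2 (hr _ _ (hab k k (leq_addr _ _) (leq_addr _ _))).
  have {}k2 : `|F (a k) - Fb (q n)| < e / 4 by apply: k2; rewrite /k; lia.
  have {}k3 : `|F (b k) - Fb p| < e / 4 by apply: k3; rewrite /k; lia.
  move: k1 k2 k3; rewrite !ltr_norml => /andP[? ?] /andP[? ?] /andP[? ?].
  by apply/andP; split; lra.
have Fi (p' : Bord d x) y : sval p' = inl y -> Fb p' = F y.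
  move=> e1; have sy : seqs p' (fun=> y) by rewrite /seqs e1.
  apply/eqP; rewrite -subr_eq0 -normr_eq0; apply/negP => /negP ne.
  have n0 : 0 < `|Fb p' - F y| by rewrite lt_neqAle eq_sym ne normr_ge0.
  by have [N hN] := hF p' _ sy _ n0; have := hN N (leqnn N); rewrite distrC ltxx.
case e1 : (sval p) => [y|B]; last by move: nbp; rewrite /is_bd e1 => /(_ I).
have e' : 0 < e / (C + 1) by rewrite divr_gt0 // ltr_wpDl.
move: cq; rewrite /bconv e1 => /(_ _ e')[N hN]; exists N => n nN.
have [y' [e2 h]] := hN n nN.
rewrite (Fi _ _ e1) (Fi _ _ e2); apply: le_lt_trans (FL _ _).1 _.
apply: (@le_lt_trans _ _ ((C + 1) * d y' y)).
  by apply: ler_wpM2r; [exact: d_ge0|rewrite lerDl].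
by rewrite mulrC -ltr_pdivlMr // ltr_wpDl.
Qed.
End Extension.

Section TestFunctions.
Context {R : realType} {X : Type} (d : X -> X -> R) (delta : R) (x : X).
Hypothesis met : is_metric d.
Hypothesis hyp : is_hyperbolic d delta.
Hypothesis delta0 : 0 <= delta.
Local Notation gp := (gprod d).

Lemma limit_range (F : X -> R) (Fb : R) (a : nat -> X) :
  (forall y, 0 <= F y <= 1) ->
  (forall e, 0 < e -> exists N, forall n, (N <= n)%N -> `|F (a n) - Fb| < e) ->
  0 <= Fb <= 1.
Proof.
move=> F01 h; apply/andP; split; rewrite leNgt; apply/negP => lt.
  have e0 : 0 < - Fb by rewrite oppr_gt0.
  have [N hN] := h _ e0; have := hN N (leqnn N); have /andP[f0 f1] := F01 (a N).
  by rewrite ltr_norml => /andP[]; lra.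
have e0 : 0 < Fb - 1 by rewrite subr_gt0.
have [N hN] := h _ e0; have := hN N (leqnn N); have /andP[f0 f1] := F01 (a N).
by rewrite ltr_norml => /andP[]; lra.
Qed.

Lemma limit_unique (F : X -> R) (l c : R) (a : nat -> X) N0 :
  (forall n, (N0 <= n)%N -> F (a n) = c) ->
  (forall e, 0 < e -> exists N, forall n, (N <= n)%N -> `|F (a n) - l| < e) -> l = c.
Proof.
move=> hc h; apply/eqP; rewrite eq_sym -subr_eq0 -normr_eq0; apply/negP => /negP ne.
have n0 : 0 < `|c - l| by rewrite lt_neqAle eq_sym ne normr_ge0.
have [N hN] := h _ n0; have := hN (maxn N N0) (leq_maxl _ _).
by rewrite hc ?leq_maxr // ltxx.
Qed.

Lemma seqs_bpt y : seqs (bpt d x y) (fun=> y).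
Proof. by []. Qed.

(** A continuous cutoff for a shadow. Stated on representing sequences, it covers boundary points
    and, through constant sequences, orbit points alike. *)
Lemma shadow_test_function (y0 : X) (T1 T2 : R) : T1 + delta + 2 <= T2 ->
  exists Fb : Bord d x -> R, [/\ bcont Fb, (forall p, 0 <= Fb p <= 1),
    (forall p a N, seqs p a -> (forall n, (N <= n)%N -> T2 <= gp x y0 (a n)) -> Fb p = 1) &
    (forall p a, seqs p a -> Fb p != 0 -> exists N, forall n, (N <= n)%N -> T1 < gp x y0 (a n))].
Proof.
move=> T12; have [F [C [C0 F01 F1 F0 FL]]] := separating_function d delta x met hyp delta0 y0 _ _ T12.
have FM y : `|F y| <= 1 by have /andP[f0 f1] := F01 y; rewrite ger0_norm.
have [Fb [cF hF]] := boundary_extension d delta x met hyp delta0 F C 1 C0 FM FL.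
exists Fb; split=> //.
- by move=> p; have [a pa] := seqs_ex d x p; apply: (limit_range F) F01 (hF p a pa).
- by move=> p a N pa h; apply: (limit_unique F _ 1 a N _ (hF p a pa)) => n /h /F1.
move=> p a pa nz; have n0 : 0 < `|Fb p| by rewrite normr_gt0.
have [N hN] := hF p a pa _ n0; exists N => n /hN h.
by rewrite ltNge; apply/negP => /F0 f0; move: h; rewrite f0 sub0r normrN ltxx.
Qed.

Lemma ball_test_function (r : R) : exists Fb : Bord d x -> R, [/\ bcont Fb,
  (forall p, 0 <= Fb p <= 1), (forall y, d x y <= r -> Fb (bpt d x y) = 1) &
  (forall y, r + 1 <= d x y -> Fb (bpt d x y) = 0)].
Proof.
pose F y := Num.max 0 (Num.min 1 (r + 1 - d x y)).
have F01 y : 0 <= F y <= 1 by rewrite /F le_max lexx ge_max ler01 /= ge_min lexx.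
have FM y : `|F y| <= 1 by have /andP[f0 f1] := F01 y; rewrite ger0_norm.
have F0 y : r + 1 <= d x y -> F y = 0.
  by move=> h; apply/max_idPl; rewrite ge_min; apply/orP; right; lra.
have F1 y : d x y <= r -> F y = 1.
  move=> h; rewrite /F (_ : Num.min 1 _ = 1); first exact/max_idPr.
  by apply/min_idPl; lra.
have Fl y y' : F y <= F y' + d y y'.
  have d0 := d_ge0 d met y y'; have /andP[f0 f1] := F01 y'.
  have /andP[g0 g1] := F01 y.
  rewrite {1}/F ge_max; apply/andP; split; first by lra.
  have [h|h] := lerP 1 (r + 1 - d x y').
    have -> : F y' = 1 by apply: F1; lra.
    by rewrite ge_min; apply/orP; left; lra.
  rewrite ge_min; apply/orP; right.
  apply: (@le_trans _ _ (r + 1 - d x y' + d y y')).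
    by have := dtri d met x y y'; lra.
  by rewrite lerD2r /F le_max; apply/orP; right; rewrite le_min lexx ltW.
(* [F] vanishes at both points when their product is at least [r + 1]; otherwise the visual size is
   at least [expR (- (visual_exp delta * (r + 1)))], which [C] compensates. *)
pose C := Num.max 1 (expR (visual_exp delta * (r + 1))).
have C1 : 1 <= C by rewrite le_max lexx.
have FL y y' : `|F y - F y'| <= C * d y y' /\ `|F y - F y'| <= C * visual d delta x y y'.
  split.
    apply: (@le_trans _ _ (d y y')); last by rewrite ler_peMl // d_ge0.
    have := Fl y y'; have := Fl y' y; rewrite (dC d met y' y) ler_norml => *.
    by apply/andP; split; lra.
  have v0 := visual_gt0 d delta x y y'.
  have [h|h] := lerP (r + 1) (gp x y y').
    rewrite F0 ?F0 ?subrr ?normr0 ?mulr_ge0 ?(ltW v0) //.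
    - by move: C1; lra.
    - exact: le_trans h (gp_ler d met _ _ _).
    - exact: le_trans h (gp_lel d met _ _ _).
  apply: (@le_trans _ _ 1).
    have /andP[? ?] := F01 y; have /andP[? ?] := F01 y'.
    by rewrite ler_norml; apply/andP; split; lra.
  apply: (@le_trans _ _ (expR (visual_exp delta * (r + 1)) * visual d delta x y y')).
    rewrite -expRD -[leLHS]expR0 ler_expR -mulrBr mulr_ge0 //; last by lra.
    exact/ltW/visual_exp_gt0.
  by apply: ler_wpM2r; [exact: ltW|rewrite le_max lexx orbT].
have C0 : 0 <= C by lra.
have [Fb [cF hF]] := boundary_extension d delta x met hyp delta0 F C 1 C0 FM FL.
have Fi y : Fb (bpt d x y) = F y by apply: (limit_unique F _ _ (fun=> y) 0%N) (hF _ _ (seqs_bpt y)).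
exists Fb; split=> //.
- by move=> p; have [a pa] := seqs_ex d x p; apply: (limit_range F) F01 (hF p a pa).
- by move=> y h; rewrite Fi F1.
- by move=> y h; rewrite Fi F0.
Qed.
End TestFunctions.

(** * Ahlfors regularity *)

Section BoundaryMeasure.
Context {R : realType} {X : Type} (d : X -> X -> R) (x : X).
Context (nu : {measure set (BordM d x) -> \bar R}).

Lemma bcont_measurable (f : Bord d x -> R) : bcont f ->
  measurable_fun [set: BordM d x] (f : BordM d x -> R).
Proof.
move=> cf; apply: (measurability _ (RGenOInfty.measurableE R)).
move=> _ [_ [r ->] <-]; rewrite setTI; apply: bopen_measurable => p q.
rewrite /= in_itv /= andbT => fp cq.
have e0 : 0 < f p - r by rewrite subr_gt0.
have [N hN] := cf p q cq _ e0; exists N => n /hN.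
by rewrite /= in_itv /= andbT ltr_norml => /andP[]; lra.
Qed.

Lemma bptP (p : Bord d x) y : sval p = inl y -> p = bpt d x y.
Proof. by case: p => q hq /= e; subst q; rewrite /bpt; congr exist; exact: Prop_irrelevance. Qed.

Lemma measure_le_integral (f : Bord d x -> R) (U : set (BordM d x)) :
  bcont f -> (forall p, 0 <= f p) -> measurable U -> (forall p, U p -> 1 <= f p) ->
  (nu U <= \int[nu]_p (f p)%:E)%E.
Proof.
move=> cf f0 mU fU; rewrite -[U]setIT -integral_indic //.
apply: ge0_le_integral; first exact: measurableT.
- by move=> p _; rewrite lee_fin indicE.
- by apply/measurable_EFinP; exact: measurable_indic.
- by apply/measurable_EFinP; exact: bcont_measurable.
- move=> p _; rewrite lee_fin indicE; case: (boolP (p \in U)) => [|_] /=; last exact: f0.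
  by rewrite inE => /fU.
Qed.

Lemma integral_le_measure (f : Bord d x -> R) (U : set (BordM d x)) :
  bcont f -> (forall p, 0 <= f p <= 1) -> measurable U -> (forall p, f p != 0 -> U p) ->
  (\int[nu]_p (f p)%:E <= nu U)%E.
Proof.
move=> cf f01 mU fU; rewrite -[U in leRHS]setIT -integral_indic //.
apply: ge0_le_integral; first exact: measurableT.
- by move=> p _; rewrite lee_fin; have /andP[] := f01 p.
- by apply/measurable_EFinP; exact: bcont_measurable.
- by apply/measurable_EFinP; exact: measurable_indic.
- move=> p _; rewrite lee_fin indicE; case: (boolP (p \in U)) => [_|].
    by have /andP[] := f01 p.
  move/negP; rewrite inE => nU; rewrite leNgt; apply/negP => fp; apply: nU; apply: fU.
  exact: lt0r_neq0.
Qed.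
End BoundaryMeasure.

(** * Transfer of the orbital estimates to the limit measure *)

Section PattersonSullivan.
Context {R : realType} {X : Type} (d : X -> X -> R) (delta D H : R) (x : X).
Context (G : set (X -> X)).
Hypothesis delta0 : 0 <= delta.
Hypothesis D0 : 0 <= D.
Hypothesis inM : in_M delta D d x G.
Hypothesis critH : (crit_exp d x G <= H%:E)%E.
Local Notation gp := (gprod d).
Local Notation C0 := (near_const delta D).
Local Notation L := (growth_const delta D).
Local Notation len g := (d x (g x)).
Local Notation psum := (orbit_sum d x G).
Local Notation psumr := (orbit_sumr d x G).
Local Notation h := (fine (crit_exp d x G)).
Let met : is_metric d := inM.1.
Let prop : is_proper d := inM.2.1.
Let geo : is_geodesic d := inM.2.2.1.
Let hyp : is_hyperbolic d delta := inM.2.2.2.1.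

Lemma crit_ge0 : (0 <= crit_exp d x G)%E.
Proof. by apply: le_ereal_inf_tmp => _ [s [s0 _] <-]; rewrite lee_fin. Qed.

Lemma crit_fine : crit_exp d x G = h%:E.
Proof.
by rewrite fineK // ge0_fin_numE ?crit_ge0 //; apply: le_lt_trans critH (ltry _).
Qed.

Lemma fine_crit_ge0 : 0 <= h.
Proof. by apply: fine_ge0; exact: crit_ge0. Qed.

Lemma fine_crit_le : h <= H.
Proof. by rewrite -lee_fin -crit_fine. Qed.

Lemma orbit_sum_above s : h < s -> (psum s setT < +oo)%E.
Proof.
rewrite -lte_fin -crit_fine => /ereal_inf_lt[_ [s' [s'0 fs'] <-]]; rewrite lte_fin => lt.
move: fs'; rewrite -orbit_sumT => fs'; apply: (@le_lt_trans _ _ ((expR 0)%:E * psum s' setT)%E).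
  apply: (orbit_sum_translate d delta D x G inM _ _ id); first exact: (G_id d delta D x G inM).
  move=> u _ _; split=> //=.
  by have := ler_wpM2r (d_ge0 d met x (u x)) (ltW lt); lra.
by rewrite expR0 mul1e.
Qed.

Lemma crit_min s : 0 <= s -> (psum s setT < +oo)%E -> h <= s.
Proof.
rewrite orbit_sumT => s0 fs; rewrite -lee_fin -crit_fine.
by apply: ereal_inf_lbound; exists s.
Qed.

(** If [h] were 0 the series would converge at [ln 2 / (2 * L)], below the threshold of
    [convergent_exponent]. *)
Lemma fine_crit_gt0 : 0 < h.
Proof.
rewrite lt_neqAle fine_crit_ge0 andbT; apply/eqP => h0.
have L0 := growth_const_gt0 delta D delta0 D0.
have ln20 : 0 < ln 2 :> R by rewrite ln_gt0 // ltr1n.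
have s0 : 0 < ln 2 / (2 * L) by rewrite divr_gt0 // mulr_gt0.
have := convergent_exponent d delta D x G delta0 D0 inM _ (ltW s0).
have fs : (psum (ln 2 / (2 * L)) setT < +oo)%E by apply: orbit_sum_above; rewrite -h0.
move=> /(_ fs).
have -> : ln 2 / (2 * L) * L = ln 2 / 2 by field; exact: lt0r_neq0.
rewrite div1r -[X in _ <= X^-1](@lnK R) ?posrE // -expRN ler_expR; lra.
Qed.

Lemma orbit_sum_crit : psum h setT = +oo%E.
Proof. exact: (divergent_at_exponent d delta D x G delta0 D0 inM _ fine_crit_gt0 crit_min). Qed.

Lemma ps_int_nonneg s (f : Bord d x -> R) : (forall p, 0 <= f p) ->
  ps_int d x G s f =
  fine (\esum_(g in (G : set {classic (X -> X)}))
    (expR (- (s * len g)) * f (bpt d x (g x)))%:E) / psumr s setT.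
Proof.
move=> f0; rewrite /ps_int /orbit_sumr orbit_sumT; congr (_ / _).
rewrite [X in _ - fine X]esum1 ?subr0; last first.
  by move=> g _; rewrite (_ : Num.max _ 0 = 0) ?mulr0 //; apply/max_idPr; rewrite oppr_le0.
congr fine; apply: eq_esum => g _; congr (_ * _)%:E; exact/max_idPl.
Qed.

Lemma ps_int_le s (f : Bord d x -> R) U : h < s -> (forall p, 0 <= f p <= 1) ->
  (forall g, G g -> f (bpt d x (g x)) != 0 -> U g) ->
  ps_int d x G s f <= psumr s U / psumr s setT.
Proof.
move=> hs f01 fU; have sfin := orbit_sum_above s hs.
have f0 p : 0 <= f p by have /andP[] := f01 p.
rewrite ps_int_nonneg //; apply: ler_wpM2r; first by rewrite invr_ge0 orbit_sumr_ge0.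
have b : (\esum_(g in (G : set {classic (X -> X)}))
    (expR (- (s * len g)) * f (bpt d x (g x)))%:E <= psum s U)%E.
  rewrite /orbit_sum [X in (_ <= X)%E]esum_mkcondr; apply: le_esum => g Gg.
  case: (boolP (g \in _)) => [_|nU].
    by rewrite lee_fin ler_piMr ?expR_ge0 //; have /andP[] := f01 (bpt d x (g x)).
  rewrite lee_fin (_ : f _ = 0) ?mulr0 //; apply/eqP; apply: contraNT nU => fn.
  by rewrite inE; apply: fU.
rewrite -lee_fin -(orbit_sum_fin d x G s sfin) fineK //.
rewrite ge0_fin_numE; last by apply: esum_ge0 => g _; rewrite lee_fin mulr_ge0 ?expR_ge0.
by apply: le_lt_trans b _; rewrite (orbit_sum_fin d x G s sfin) ltry.
Qed.

Lemma ps_int_ge s (f : Bord d x -> R) U : h < s -> (forall p, 0 <= f p <= 1) ->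
  (forall g, G g -> U g -> f (bpt d x (g x)) = 1) ->
  psumr s U / psumr s setT <= ps_int d x G s f.
Proof.
move=> hs f01 fU; have sfin := orbit_sum_above s hs.
have f0 p : 0 <= f p by have /andP[] := f01 p.
rewrite ps_int_nonneg //; apply: ler_wpM2r; first by rewrite invr_ge0 orbit_sumr_ge0.
set E := (X in fine X).
have b1 : (psum s U <= E)%E.
  rewrite /orbit_sum [X in (X <= _)%E]esum_mkcondr; apply: le_esum => g Gg.
  case: (boolP (g \in _)) => [|_]; last by rewrite lee_fin mulr_ge0 ?expR_ge0.
  by rewrite inE => Ug; rewrite fU // mulr1.
have b2 : (E <= psum s setT)%E.
  rewrite /orbit_sum setIT; apply: le_esum => g Gg; rewrite lee_fin.
  by rewrite ler_piMr ?expR_ge0 //; have /andP[] := f01 (bpt d x (g x)).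
rewrite -lee_fin -(orbit_sum_fin d x G s sfin) fineK // ge0_fin_numE.
  exact: le_lt_trans b2 sfin.
by apply: le_trans b1; exact: orbit_sum_ge0.
Qed.

Context (nu : {measure set (BordM d x) -> \bar R}).
Hypothesis PS : is_PS d x G h nu.

(** Hides the sequence of exponents: bounds uniform in [s] just above [h] pass to the integral. *)
Lemma PS_eventually (f : Bord d x -> R) (eta : R) : bcont f -> 0 < eta -> exists s0, h < s0 /\
  forall c : R,
  ((forall s, h < s < h + eta -> s <= s0 -> ps_int d x G s f <= c) ->
    (\int[nu]_p (f p)%:E <= c%:E)%E) /\
  ((forall s, h < s < h + eta -> s <= s0 -> c <= ps_int d x G s f) ->
    (c%:E <= \int[nu]_p (f p)%:E)%E).
Proof.
move=> cf eta0; have [s [hs [sdec [scv sint]]]] := PS.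
exists (s 0%N); split; first exact: hs.
have sle i : s i <= s 0%N by elim: i => // i IH; exact: le_trans (sdec i) IH.
have near_s : \forall i \near \oo, s i < h + eta by apply: (cvgr_lt _ scv); rewrite ltrDl.
move=> c; split=> hc.
  apply: cvge_le (sint f cf); near=> i; rewrite lee_fin; apply: hc; last exact: sle.
  by rewrite hs /=; near: i.
apply: cvge_ge (sint f cf); near=> i; rewrite lee_fin; apply: hc; last exact: sle.
by rewrite hs /=; near: i.
Unshelve. all: by end_near.
Qed.

Lemma bopen_interior_ball (r : R) :
  bopen [set p : Bord d x | exists y, sval p = inl y /\ d x y < r].
Proof.
move=> p q [y [py yn]]; rewrite /bconv py => /(_ (r - d x y)).
rewrite subr_gt0 => /(_ yn)[N hN]; exists N => k /hN[y' [qy hy]]; exists y'; split=> //.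
by have := dtri d met x y y'; rewrite (dC d met y y'); lra.
Qed.

(** The unnormalised mass of a bounded ball stays bounded as [s] decreases to [h], while the
    normalising total tends to infinity. *)
Lemma PS_interior_ball (n : nat) :
  nu ([set p : Bord d x | exists y, sval p = inl y /\ d x y < n%:R] : set (BordM d x)) = 0%E.
Proof.
have oW := bopen_interior_ball n%:R; set W := (X in nu X).
have [c [cc c01 c1 c0]] := ball_test_function d delta x met hyp delta0 n%:R.
have cc0 p : 0 <= c p by have /andP[] := c01 p.
have le : (nu W <= \int[nu]_p (c p)%:E)%E.
  apply: measure_le_integral => //; first exact: bopen_measurable.
  by move=> p [y [py yn]]; rewrite (bptP d x p y py) c1 // ltW.
apply/le_anti; rewrite measure_ge0 andbT; apply: le_trans le _.
apply/lee_addgt0Pr => e e0; rewrite add0e.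
have f0 : (psum (h + 1) setT < +oo)%E by apply: orbit_sum_above; rewrite ltrDl.
(* On elements of length at most [n%:R + 1], replacing [s] by [h + 1] changes the weights by at most
   [expR (n%:R + 1)]; no count of orbit points is needed. *)
pose Q := expR (n%:R + 1) * psumr (h + 1) setT.
have Q0 : 0 <= Q by rewrite mulr_ge0 ?expR_ge0 // orbit_sumr_ge0.
have [eta eta0 heta] := orbit_sum_blowup d delta D x G inM h (Q / e) orbit_sum_crit.
have eta10 : 0 < Num.min eta 1 by rewrite lt_min eta0 ltr01.
have [s1 [hs1 hlim]] := PS_eventually c _ cc eta10.
apply: (hlim e).1 => s /andP[hs hs'] _.
have sfin := orbit_sum_above s hs.
have /(ps_int_le s c [set g : X -> X | len g <= n%:R + 1] hs c01) : forall g, G g ->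
    c (bpt d x (g x)) != 0 -> len g <= n%:R + 1.
  by move=> g _ cn; rewrite leNgt; apply/negP => lt; move: cn; rewrite c0 ?eqxx // ltW.
move=> /le_trans; apply.
have T0 : 0 < psumr s setT.
  by apply: (orbit_sumr_gt0 d x G s sfin _ id) => //; exact: (G_id d delta D x G inM).
rewrite ler_pdivrMr //; apply: (@le_trans _ _ Q).
  rewrite -lee_fin EFinM -(orbit_sum_fin d x G s sfin) -(orbit_sum_fin d x G (h + 1) f0).
  apply: (orbit_sum_translate d delta D x G inM _ _ id); first exact: (G_id d delta D x G inM).
  move=> u _ /= hu; split=> //.
  have l0 := d_ge0 d met x (u x).
  have h1 : h + 1 - s <= 1 by lra.
  have := ler_wpM2r l0 h1; lra.
rewrite mulrC -ler_pdivrMr // -lee_fin -(orbit_sum_fin d x G s sfin); apply: heta.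
by rewrite hs /=; apply: lt_le_trans hs' _; rewrite lerD2l ge_min lexx.
Qed.

Lemma PS_interior : nu ([set p : Bord d x | ~ is_bd p] : set (BordM d x)) = 0%E.
Proof.
have mI : measurable ([set p : Bord d x | ~ is_bd p] : set (BordM d x)).
  by apply: bopen_measurable; exact: bopen_interior.
apply: measure_negligible => //.
have -> : [set p : Bord d x | ~ is_bd p] =
    \bigcup_n [set p : Bord d x | exists y, sval p = inl y /\ d x y < n%:R].
  apply/seteqP; split=> p /=.
    rewrite /is_bd; case e : (sval p) => [y|//] _.
    have [N hN] := nat_unbounded (d x y); exists N.+1 => //; exists y; split=> //.
    by apply: le_lt_trans (hN N (leqnn N)) _; rewrite ltr_nat.
  by move=> [n _ [y [e _]]]; rewrite /is_bd e.
apply: negligible_bigcup => n; apply/negligibleP; last exact: PS_interior_ball.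
exact: bopen_measurable (bopen_interior_ball _).
Qed.

Context (z : Bord d x) (rho : R).
Hypothesis Lz : limit_set d x G z.
Local Notation t := (ln (1 / rho)).
Hypothesis t0 : 0 <= t.

Lemma vball_upper :
  (nu (vball z rho) <=
    (expR ((H + 1) * (5 * C0 + 8 * delta + 4)) * expR (- (h * t)))%:E)%E.
Proof.
have C01 := near_const_ge1 delta D delta0 D0.
have [a za] := seqs_ex d x z; have bz : is_bd z by case: Lz.
have [g [Gg [/andP[g1 g2] [N hN]]]] := orbit_toward d delta D x G delta0 D0 inM z a t Lz za t0.
(* [C0 + delta] is lost in [orbit_toward] and [2 * delta] in passing from the sequence for [z] to
   one for [p] by [hyp4]. *)
pose T2 := t - C0 - 3 * delta; pose T1 := T2 - delta - 2.
have [|F [cF F01 F1 F0]] := shadow_test_function d delta x met hyp delta0 (g x) T1 T2.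
  by rewrite /T1; lra.
have Fge0 p : 0 <= F p by have /andP[] := F01 p.
apply: (@le_trans _ _ (\int[nu]_p (F p)%:E)%E).
  apply: measure_le_integral => //; first exact: measurable_vball.
  move=> p [bp hp]; have [a' [b [N1 [za' pb hab]]]] := egp_gt d x _ _ _ hp.
  have [N2 h2] := seqs_equiv d delta x met hyp _ _ _ bz za za' t.
  rewrite (F1 p b N1) // => m hm.
  pose n := (N + (N1 + N2))%N.
  have [n1 [n2 n3]] : (N <= n /\ N1 <= n /\ N2 <= n)%N by rewrite /n; clear; lia.
  have k1 := hN n n1.
  have k2 : t - C0 - delta <= gp x (a n) (a' n).
    by have := ltW (h2 n n n3 n3); move: C01 delta0; lra.
  have k3 : t - C0 - delta <= gp x (a' n) (b m).
    by have := ltW (hab n m n2 hm); move: C01 delta0; lra.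
  by have := hyp4 d delta hyp delta0 _ _ _ _ _ _ k1 k2 k3; rewrite /T2; lra.
have [s0 [_ hlim]] := PS_eventually F 1 cF ltr01.
apply: (hlim _).1 => s /andP[hs hs1] _.
have sfin := orbit_sum_above s hs.
have sge0 : 0 <= s by apply: le_trans fine_crit_ge0 (ltW hs).
have sS : s <= H + 1 by have := fine_crit_le; lra.
(* Since [len g <= t + C0], this makes [len g - K] at most [T1]; [2 * K + C0] is then the constant
   in the statement. *)
pose K := 2 * C0 + 4 * delta + 2.
have sub u : G u -> F (bpt d x (u x)) != 0 -> shadow d x g K u.
  move=> Gu /(F0 _ _ (seqs_bpt d x (u x)))[N' hN']; have := hN' N' (leqnn _).
  by rewrite /shadow /= /T1 /T2 /K; lra.
apply: (le_trans (ps_int_le s F _ hs F01 sub)).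
have T0 : 0 < psumr s setT.
  by apply: (orbit_sumr_gt0 d x G s sfin _ id) => //; exact: (G_id d delta D x G inM).
rewrite ler_pdivrMr //; apply: (le_trans (shadow_upper d delta D x G inM s sge0 sfin g K Gg)).
apply: ler_wpM2r; first exact: ltW.
rewrite -expRD ler_expR.
have h1 : s * (t - C0) <= s * len g by apply: ler_wpM2l.
have h2 : s * (5 * C0 + 8 * delta + 4) <= (H + 1) * (5 * C0 + 8 * delta + 4).
  by apply: ler_wpM2r => //; move: C01 delta0; lra.
have h3 : h * t <= s * t by apply: ler_wpM2r => //; exact: ltW.
by rewrite /K; lra.
Qed.

(** The orbit point is taken [C1] deeper than [t], so that even the support of the test function,
    which is wider than the shadow, meets the boundary inside the ball. *)
Lemma vball_lower (n : nat) (C1 : R) :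
  expR ((H + 1) * (4 * C0 + 2 * delta)) <= 2 ^+ n ->
  C1 = C0 + (C0 + n.+1%:R * L) + 2 * delta + 3 ->
  ((expR (- (h * t)) / (2 * expR ((H + 1) * (C1 + C0) + 1)))%:E <= nu (vball z rho))%E.
Proof.
move=> hn; set K := C0 + n.+1%:R * L => eC1.
have C01 := near_const_ge1 delta D delta0 D0.
have L0 := growth_const_gt0 delta D delta0 D0.
have K0 : 0 <= K by rewrite /K addr_ge0 ?mulr_ge0 // ?ltW //; lra.
have C10 : 0 <= C1 by rewrite eC1; move: delta0; lra.
have [a za] := seqs_ex d x z; have bz : is_bd z by case: Lz.
have [g [Gg [/andP[g1 g2] [N hN]]]] :=
  orbit_toward d delta D x G delta0 D0 inM z a (t + C1) Lz za (addr_ge0 t0 C10).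
pose T2 := len g - K; pose T1 := T2 - delta - 2.
have [|F [cF F01 F1 F0]] := shadow_test_function d delta x met hyp delta0 (g x) T1 T2.
  by rewrite /T1; lra.
have mB := measurable_vball d delta x met hyp geo prop delta0 z rho bz.
have mI : measurable ([set p : Bord d x | ~ is_bd p] : set (BordM d x)).
  by apply: bopen_measurable; exact: bopen_interior.
(* The test function may be positive on [X]; adding this null set to the ball costs nothing. *)
apply: (@le_trans _ _ (nu (vball z rho `|` ([set p : Bord d x | ~ is_bd p] : set (BordM d x))))); last first.
  apply: (le_trans (measureU2 nu mB mI)); rewrite -[leRHS]adde0; apply: leeD => //.
  by rewrite le_eqVlt; apply/orP; left; apply/eqP; exact: PS_interior.
apply: (@le_trans _ _ (\int[nu]_p (F p)%:E)%E); last first.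
  apply: integral_le_measure => //; first exact: measurableU.
  move=> p Fp; have [bp|nbp] := pselect (is_bd p); last by right.
  left; split=> //; have [b pb] := seqs_ex d x p.
  have [N1 h1] := F0 p b pb Fp.
  apply: (@lt_le_trans _ _ (t + 1)%:E); first by rewrite lte_fin ltrDl.
  apply: (egp_ge d x z p _ a b (maxn N N1)) => // i j.
  rewrite !geq_max => /andP[i1 i2] /andP[j1 j2].
  have k1 : t + 1 + delta <= gp x (a i) (g x).
    by rewrite (gpC d met); have := hN i i1; rewrite eC1; move: delta0; lra.
  have k2 : t + 1 + delta <= gp x (g x) (b j).
    by have := ltW (h1 j j2); rewrite /T1 /T2; move: g1; rewrite eC1; lra.
  by have := hyp3 d delta hyp _ _ _ _ _ k1 k2; lra.
(* Gives [s - h <= 1] and [(s - h) * t <= 1], the latter accounting for the [+ 1] in the exponent;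
   the denominator [t + 1] is safe at [t = 0]. *)
have eta0 : 0 < Num.min 1 (1 / (t + 1)) by rewrite lt_min ltr01 divr_gt0 // ltr_wpDl.
have [s0 [_ hlim]] := PS_eventually F _ cF eta0.
apply: (hlim _).2 => s /andP[hs hs1] _.
have sfin := orbit_sum_above s hs.
have sge0 : 0 <= s by apply: le_trans fine_crit_ge0 (ltW hs).
have [sh1 sht] : s - h <= 1 /\ (s - h) * t <= 1.
  have e1 : s - h <= 1.
    have : Num.min 1 (1 / (t + 1)) <= 1 by rewrite ge_min lexx.
    by lra.
  split=> //; have e2 : s - h <= 1 / (t + 1).
    have : Num.min 1 (1 / (t + 1)) <= 1 / (t + 1) by rewrite ge_min lexx orbT.
    by lra.
  move: e2; rewrite ler_pdivlMr ?ltr_wpDl // mulrDr mulr1; lra.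
have sS : s <= H + 1 by have := fine_crit_le; lra.
have one u : G u -> shadow d x g K u -> F (bpt d x (u x)) = 1.
  by move=> Gu hu; apply: (F1 _ _ 0%N (seqs_bpt d x (u x))).
apply: le_trans (ps_int_ge s F _ hs F01 one).
have T0 : 0 < psumr s setT.
  by apply: (orbit_sumr_gt0 d x G s sfin _ id) => //; exact: (G_id d delta D x G inM).
rewrite ler_pdivlMr //.
have s0S : 0 <= s <= H + 1 by rewrite sge0.
apply: le_trans (shadow_lower d delta D x G delta0 D0 inM s (H + 1) n g s0S sfin hn Gg).
apply: ler_wpM2r; first exact: ltW.
rewrite invfM mulrCA mulrC -expRN -expRD; apply: ler_wpM2r; first by rewrite invr_ge0.
rewrite ler_expR.
have q1 : s * len g <= s * (t + C1 + C0) by apply: ler_wpM2l.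
have q2 : s * (C1 + C0) <= (H + 1) * (C1 + C0) by apply: ler_wpM2r => //; lra.
lra.
Qed.
End PattersonSullivan.

Theorem mainTheorem3 (R : realType) (delta D H : R) :
  0 <= delta -> 0 <= D -> 0 <= H ->
  exists A : R, 1 <= A /\
    forall (X : Type) (d : X -> X -> R) (x : X) (G : set (X -> X)),
      in_M delta D d x G ->
      (crit_exp d x G <= H%:E)%E ->
      forall nu : {measure set (BordM d x) -> \bar R},
        is_PS d x G (fine (crit_exp d x G)) nu ->
        forall (z : Bord d x) (rho : R),
          limit_set d x G z -> 0 < rho <= 1 ->
          ((rho `^ fine (crit_exp d x G) / A)%:E <= nu (vball z rho))%E /\
          (nu (vball z rho) <= (A * rho `^ fine (crit_exp d x G))%:E)%E.
Proof.
move=> delta0 D0 H0; pose C0 := near_const delta D; pose L := growth_const delta D.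
have C01 := near_const_ge1 delta D delta0 D0.
(* [n] sets the shadow thickness of [shadow_lower] for all exponents up to [H + 1]; it depends on
   [delta], [D] and [H] only. *)
have [n hn] : exists n : nat, expR ((H + 1) * (4 * C0 + 2 * delta)) <= 2 ^+ n.
  have [n hn] := nat_unbounded (expR ((H + 1) * (4 * C0 + 2 * delta))).
  exists n; apply: le_trans (hn n (leqnn n)) _.
  by rewrite -natrX ler_nat ltnW // ltn_expl.
pose C1 := C0 + (C0 + n.+1%:R * L) + 2 * delta + 3.
pose A1 := expR ((H + 1) * (5 * C0 + 8 * delta + 4)).
pose A2 := 2 * expR ((H + 1) * (C1 + C0) + 1).
have A11 : 1 <= A1.
  by rewrite /A1 -[leLHS]expR0 ler_expR mulr_ge0 //; rewrite /C0; lra.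
have A20 : 0 < A2 by rewrite mulr_gt0 // expR_gt0.
exists (A1 + A2); split; first by lra.
move=> X d x G inM critH nu PS z rho Lz /andP[rho0 rho1].
set h := fine _ in PS *.
have et : ln (1 / rho) = - ln rho by rewrite div1r lnV ?posrE.
have t0 : 0 <= ln (1 / rho) by rewrite et oppr_ge0 ln_le0.
have -> : rho `^ h = expR (- (h * ln (1 / rho))).
  by rewrite /powR gt_eqF // et mulrN opprK.
have e0 := expR_gt0 (- (h * ln (1 / rho))).
split.
  apply: le_trans (vball_lower d delta D H x G delta0 D0 inM critH nu PS z rho Lz t0 n C1 hn erefl).
  by rewrite lee_fin ler_pM2l // -[leRHS]/(A2^-1) lef_pV2 ?posrE //; lra.
apply: le_trans (vball_upper d delta D H x G delta0 D0 inM critH nu PS z rho Lz t0) _.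
by rewrite lee_fin ler_pM2r // lerDl ltW.
Qed.
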